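(* Let $\psi \in \mathrm{Lip}(V)$ and let $x \in \mathcal{M}(\Omega;V)$ be an independent initial. Then the convergence $$\lim_{t \rightarrow \infty } \frac{1}{t} \int_{0}^{t} \psi (\mathbb{X}_{x}(\tau))\, d\tau =\overline{(\psi)}$$ takes place with probability one.
   Context: $(\Omega,\mathcal{F},\mathbb{P})$ is a complete probability space, $(V,\|\cdot\|_V)$ is a separable real Banach space, $V\ne\{0\}$, with Borel $\sigma$-algebra $\mathfrak{B}(V)$, and $\mathcal{M}(\Omega;V)$ is the set of all $V$-valued random variables ($\mathcal{F}$-$\mathfrak{B}(V)$-measurable maps). $\mathrm{Lip}(V)$ is the space of Lipschitz continuous $\psi:V\to\mathbb{R}$. A semigroup on $V$ is a family of (not necessarily linear) maps $T(t):V\to V$, $t\ge 0$, with $T(0)v=v$ and $T(t+h)v=T(t)T(h)v$ for all $t,h\ge0$, $v\in V$; it is time-continuous if $t\mapsto T(t)v$ is continuous on $[0,\infty)$ for every $v\in V$, and contractive if $\|T(t)v_1-T(t)v_2\|_V\le\|v_1-v_2\|_V$ for all $t\ge0$, $v_1,v_2\in V$. Standing assumptions: $(T(t))_{t\ge0}$ is a time-continuous, contractive semigroup on $V$; $(\eta_m)_{m\in\mathbb{N}}\subseteq\mathcal{M}(\Omega;V)$ is i.i.d. with $\|\eta_k\|_V\in L^2(\Omega)$ for all $k$; $(\beta_m)_{m\in\mathbb{N}}$, $\beta_m:\Omega\to(0,\infty)$, is an i.i.d. sequence of exponentially distributed random variables with parameter $\theta\in(0,\infty)$; the two sequences are independent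 of each other. Moreover there is a separable Banach space $(W,\|\cdot\|_W)$, $W\subseteq V$, such that: (1) the injection $W\hookrightarrow V$ is continuous and $W$ is dense in $(V,\|\cdot\|_V)$; (2) $T(t)w\in W$ for all $w\in W$, $t\ge0$; (3) there are constants $\kappa,\rho\in(0,\infty)$ with $\|T(t)w_1-T(t)w_2\|_W\le\big(\kappa t+\|w_1-w_2\|_W^{-1/\rho}\big)^{-\rho}$ for all $w_1,w_2\in W$, $t\in[0,\infty)$, where the right-hand side is understood as $0$ if $w_1=w_2$; (4) $T(t)0=0$ for all $t\ge0$. Set $\alpha_0:=0$, $\alpha_m:=\sum_{k=1}^m\beta_k$. An $x\in\mathcal{M}(\Omega;V)$ is an independent initial if $x$ is jointly independent of $((\eta_m)_{m\in\mathbb{N}},(\beta_m)_{m\in\mathbb{N}})$; constants $v\in V$ are independent initials. For an independent initial $x$ set $\mathsf{x}_{x,0}:=x$, $\mathsf{x}_{x,m}:=T(\beta_m)\mathsf{x}_{x,m-1}+\eta_m$ for $m\in\mathbb{N}$, and $\mathbb{X}_x(t):=\sum_{m=0}^\infty T((t-\alpha_m)_+)(\mathsf{x}_{x,m})\mathbf{1}_{[\alpha_m,\alpha_{m+1})}(t)$ for $t\ge0$. Set $P(t,v,B):=\mathbb{P}(\mathbb{X}_v(t)\in B)$. Under these assumptions there is a unique probability measure $\bar\mu$ on $\mathfrak{B}(V)$ with $\int_V P(t,v,B)\,\bar\mu(dv)=\bar\mu(B)$ for all $t\ge0$, $B\in\mathfrak{B}(V)$, and every $\psi\in\mathrm{Lip}(V)$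 belongs to $L^2(V,\mathfrak{B}(V),\bar\mu)$. Notation: $\overline{(\psi)}:=\int_V\psi(v)\,\bar\mu(dv)$. *)

(* Defs.v *)
From HB Require Import structures.
From mathcomp Require Import all_boot all_order all_algebra finmap.
From mathcomp Require Import all_classical all_reals all_analysis.

Set Implicit Arguments.
Unset Strict Implicit.
Unset Printing Implicit Defensive.

Import Order.TTheory GRing.Theory Num.Theory.
Import numFieldNormedType.Exports.

Local Open Scope classical_set_scope.
Local Open Scope ring_scope.

Definition borel (V : ptopologicalType) := g_sigma_algebraType (@open V).

Definition separable_space (V : topologicalType) :=
  exists2 D : set V, countable D & dense D.

(* Semigroups are functions T : R -> V -> V; only the maps T t with 0 <= t are
   constrained. *)
Section Semigroup.
Context {R : realType} {V : completeNormedModType R}.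
Implicit Type T : R -> V -> V.

Definition semigroup T :=
  (forall v, T 0 v = v) /\
  (forall t h v, 0 <= t -> 0 <= h -> T (t + h) v = T t (T h v)).

Definition time_continuous T :=
  forall v, {within `[0, +oo[, continuous (fun t => T t v)}.

Definition contractive T :=
  forall t v1 v2, 0 <= t -> `|T t v1 - T t v2| <= `|v1 - v2|.

End Semigroup.

Section Independence.
Context {d : measure_display} {Omega : measurableType d} {R : realType}.
Variable P : probability Omega R.

Definition sigma_rv {d' : measure_display} {S : measurableType d'}
    (X : Omega -> S) : set (set Omega) :=
  preimage_set_system setT X measurable.

Definition sigma_seq {d' : measure_display} {S : measurableType d'}
    (X : nat -> Omega -> S) : set (set Omega) :=
  <<s \bigcup_m sigma_rv (X m) >>.

Definition independent2 (F G : set (set Omega)) :=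
  forall A B, F A -> G B -> P (A `&` B) = (P A * P B)%E.

Definition mutually_independent {I : choiceType} (F : I -> set (set Omega)) :=
  forall (J : {fset I}) (E : I -> set Omega),
    (forall i, i \in J -> F i (E i)) ->
    P (\bigcap_(i in [set` J]) E i) = (\prod_(i <- J) P (E i))%E.

Definition independent_rvs {d' : measure_display} {S : measurableType d'}
    (X : nat -> Omega -> S) :=
  mutually_independent (fun m => sigma_rv (X m)).

Definition identically_distributed {d' : measure_display}
    {S : measurableType d'} (X : nat -> {RV P >-> S}) :=
  forall m n (B : set S), measurable B ->
    distribution P (X m) B = distribution P (X n) B.

Definition exponentially_distributed (theta : R) (X : {RV P >-> R}) :=
  forall B : set R, measurable B ->
    distribution P X B = exponential_prob theta B.

Definition independent_initial {V : completeNormedModType R}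
    (eta : nat -> Omega -> borel V) (beta : nat -> Omega -> R)
    (x : Omega -> borel V) :=
  independent2 (sigma_rv x) <<s sigma_seq eta `|` sigma_seq beta >>.

End Independence.

(* The index set {1, 2, ...} of the noise sequences is shifted to nat:
   eta m and beta m stand for eta_{m+1} and beta_{m+1}. *)
Section Process.
Context {Omega : Type} {R : realType} {V : completeNormedModType R}.
Variables (T : R -> V -> V) (eta : nat -> Omega -> V) (beta : nat -> Omega -> R).

Definition arrival (m : nat) (w : Omega) : R := \sum_(k < m) beta k w.

Fixpoint chain (x : Omega -> V) (m : nat) (w : Omega) : V :=
  if m is m'.+1 then T (beta m' w) (chain x m' w) + eta m' w else x w.

Definition process (x : Omega -> V) (t : R) (w : Omega) : V :=
  limn [series \1_(`[arrival m w, arrival m.+1 w[%classic : set R) t *: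
                 T (Num.max (t - arrival m w) 0) (chain x m w)]_m.

End Process.

Section Invariance.
Context {d : measure_display} {Omega : measurableType d} {R : realType}
  {V : completeNormedModType R}.
Variables (P : probability Omega R) (T : R -> V -> V)
  (eta : nat -> Omega -> V) (beta : nat -> Omega -> R).

Definition transition (t : R) (v : V) (B : set V) : \bar R :=
  P [set w | B (process T eta beta (cst v) t w)].

Definition invariant_measure (mu : probability (borel V) R) :=
  forall (t : R) (B : set (borel V)), 0 <= t -> measurable B ->
    (\int[mu]_v transition t v B = mu B)%E.

End Invariance.

(* Main.v *)
Require Import Defs.
From HB Require Import structures.
From mathcomp Require Import all_boot all_order all_algebra finmap.
From mathcomp Require Import all_classical all_reals all_analysis.
From mathcomp Require Import measurable_realfun zify ring lra.

Set Implicit Arguments.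
Unset Strict Implicit.
Unset Printing Implicit Defensive.

Import Order.TTheory GRing.Theory Num.Theory.
Import numFieldNormedType.Exports.

Local Open Scope classical_set_scope.
Local Open Scope ring_scope.

(** The idea. Between two arrivals the process follows the contractive
semigroup, and at an arrival it jumps by an independent amount. The decay in
[W] has a bound that does not depend on the distance of the starting points;
since [W] is dense and its injection bounded, the semigroup on [V] therefore
coalesces: for every tolerance [eps] there is a duration [r] after which any
two trajectories are [eps]-close ([coalescing_of_decay]). Contractivity keeps
them so, for the jumps cancel in differences.

Hence, after the first leg longer than [r], the chain of the process stays
[eps]-close to the reset chain, which goes back to the origin whenever a leg
lasts at least [r] ([chain_reset_close]), and this holds for every initial
value. Resets make the correlations of the reset chain decay geometrically:
two legs are independent unless all legs between them are short
([reset_leg_correlation]). So the sum of [n] leg integrals has variance of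
order [n] ([reset_leg_variance]), and Chebyshev's inequality along the squares
together with monotonicity gives a strong law with deterministic centering,
the sum of the means ([strong_law_of_variance]). The observable [1] gives the
asymptotics of the arrival times. For every [eps], the sum of the means thus
describes the time integral of the process up to an error proportional to
[eps] times the elapsed time.

The limit is identified through the invariant measure [mu]. If the process
starts from [mu], independently of the noise, its time average over [[0, t]]
has mean exactly [\int[mu]_v psi v] by Tonelli's theorem, so for bounded [psi]
dominated convergence compares this number with the means along the reset
chain ([identify_limit]), and these drop out. A nonnegative Lipschitz [psi] is
the sum of a truncation and of an excess over a high level, whose time
averages are small by the same strong law and second moment bounds
([ae_observable]). Monotonicity of the time integral passes from arrival times
to continuous time ([cvg_average_of_arrivals]), and a signed [psi] is a
difference of two nonnegative ones. *)

(** * Measurability of maps into separable Banach spaces *)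

Section SeparableMeasurability.
Context {R : realType}.

Lemma dense_sequence (V : completeNormedModType R) : separable_space V ->
  exists s : nat -> V, forall (v : V) (e : R), 0 < e -> exists n, ball (s n) e v.
Proof.
move=> [D cD dD].
have cnt : (D #<= [set: nat])%card := cD.
have [D0|[g]] := pfcard_geP cnt.
  by have [x [_]] := dD setT (ex_intro _ 0 I) openT; rewrite D0.
exists g => v e e0.
have oB : open (ball v e) by exact: ball_open.
have /(dD _)/(_ oB) : ball v e !=set0 by exists v; exact: ballxx.
move=> [y [vy Dy]]; have [n _ gn] := @surj _ _ _ _ g _ Dy.
by exists n; rewrite gn; exact: ball_sym.
Qed.

Lemma dense_sequence_real :
  exists s : nat -> R, forall (v : R) (e : R), 0 < e -> exists n, ball (s n) e v.
Proof.
have cnt : (range (@ratr R) #<= [set: nat])%card.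
  by apply: (card_le_trans (card_image_le _ _)); exact: countableP.
have [D0|[g]] := pfcard_geP cnt.
  by have : range (@ratr R) (ratr 0) by []; rewrite D0.
exists g => v e e0.
have oB : open (ball v e) by exact: ball_open.
have /(dense_rat)/(_ oB) : ball v e !=set0 by exists v; exact: ballxx.
move=> [y [vy Dy]]; have [n _ gn] := @surj _ _ _ _ g _ Dy.
by exists n; rewrite gn; exact: ball_sym.
Qed.

Section TwoVariables.
Context {d : measure_display} {S : measurableType d}.
Variables (A B C : pseudoMetricType R).
Variables (sA : nat -> A) (sB : nat -> B).
Hypothesis dA : forall (v : A) (e : R), 0 < e -> exists n, ball (sA n) e v.
Hypothesis dB : forall (v : B) (e : R), 0 < e -> exists n, ball (sB n) e v.

(** An open set pulled back along F is a countable union of rectangles of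
balls; this is where separability enters, since the Borel sigma-algebra of
a product of nonseparable spaces may exceed the product one. *)
Lemma measurable_preimage_continuous2 (f : S -> A) (g : S -> B)
    (F : A -> B -> C) (U : set C) :
  (forall a e, measurable (f @^-1` ball a e)) ->
  (forall b e, measurable (g @^-1` ball b e)) ->
  (forall a b, U (F a b) -> exists2 e : R, 0 < e &
    forall a' b', ball a e a' -> ball b e b' -> U (F a' b')) ->
  measurable ((fun w => F (f w) (g w)) @^-1` U).
Proof.
move=> mf mg cF.
pose Q (t : nat * nat * nat) := forall a b,
  ball (sA t.1.1) t.2.+1%:R^-1 a -> ball (sB t.1.2) t.2.+1%:R^-1 b -> U (F a b).
pose r (t : nat * nat * nat) : R := t.2.+1%:R^-1.
have -> : (fun w => F (f w) (g w)) @^-1` U =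
  \bigcup_(t in Q) ((f @^-1` ball (sA t.1.1) (r t)) `&`
                    (g @^-1` ball (sB t.1.2) (r t))).
  apply/seteqP; split => [w /= /cF[e e0 He]|w [t Qt [/= fw gw]]]; last exact: Qt.
  have e2 : 0 < e / 2 by rewrite divr_gt0.
  have [k _ /(_ _ (leqnn k)) /= ke] := near_infty_natSinv_lt (PosNum e2).
  have k0 : (0 : R) < k.+1%:R^-1 by rewrite invr_gt0.
  have [n nf] := dA (f w) k0.
  have [m mg'] := dB (g w) k0.
  have ke2 : k.+1%:R^-1 + k.+1%:R^-1 <= e.
    rewrite (splitr e); apply: lerD; exact: ltW.
  exists (n, m, k) => //= a b /= na mb; apply: He.
  - apply: (le_ball ke2).
    by apply: ball_triangle na; exact: ball_sym.
  - apply: (le_ball ke2).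
    by apply: ball_triangle mb; exact: ball_sym.
rewrite bigcup_mkcond; apply: countable_bigcupT_measurable => [|t].
  exact: countableP.
by case: ifPn => // _; exact: measurableI.
Qed.

End TwoVariables.

Lemma measurable_to_borel {d} {S : measurableType d} (V : completeNormedModType R)
    (f : S -> borel V) :
  (forall U : set V, open U -> measurable (f @^-1` U)) -> measurable_fun setT f.
Proof.
move=> mf; apply: (@measurability _ _ _ (borel V) _ _ (@open V)) => //.
by move=> _ [U oU <-]; rewrite setTI; exact: mf.
Qed.

Lemma measurable_to_real {d} {S : measurableType d} (f : S -> R) :
  (forall U : set R, open U -> measurable (f @^-1` U)) -> measurable_fun setT f.
Proof.
move=> mf; apply: (measurability _ (RGenOInfty.measurableE R)) => _ [_ [a ->] <-].
by rewrite setTI; apply: mf; exact: interval_open.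
Qed.

Lemma measurable_preimage_open {d} {S : measurableType d}
    (V : completeNormedModType R) (f : S -> borel V) (U : set V) :
  measurable_fun setT f -> open U -> measurable (f @^-1` U).
Proof.
move=> mf oU; rewrite -[X in measurable X]setTI; apply: mf => //.
exact: sub_sigma_algebra.
Qed.

Lemma measurable_continuous_borel {d} {S : measurableType d}
    (V : completeNormedModType R) (f : S -> borel V) (g : V -> R) :
  measurable_fun setT f -> continuous g -> measurable_fun setT (fun w => g (f w)).
Proof.
move=> mf cg; apply: measurable_to_real => U oU.
rewrite -[_ @^-1` U]/(f @^-1` (g @^-1` U)); apply: measurable_preimage_open => //.
by apply: open_comp => // x _; exact: cg.
Qed.

End SeparableMeasurability.

(** * Asymptotic coalescence of the semigroup *)

Section ContractiveFlow.
Context {R : realType} {V : completeNormedModType R} (T : R -> V -> V).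
Hypotheses (hVsep : separable_space V)
  (hTcont : time_continuous T) (hTcontr : contractive T)
  (hT0 : forall t : R, 0 <= t -> T t 0 = 0).

Lemma max0_ge0 (t : R) : 0 <= Num.max t 0.
Proof. by rewrite le_max lexx orbT. Qed.

Lemma flow_norm_le t v : 0 <= t -> `|T t v| <= `|v|.
Proof.
by move=> t0; have := hTcontr v 0 t0; rewrite hT0// !subr0.
Qed.

(** Joint continuity: moving the starting point costs no more than its
displacement, uniformly in time, so continuity in time at one point suffices. *)
Lemma flow_continuous2 (t : R) (v : V) (U : set V) : open U ->
  U (T (Num.max t 0) v) -> exists2 e : R, 0 < e &
    forall t' v', ball t e t' -> ball v e v' -> U (T (Num.max t' 0) v').
Proof.
move=> oU Utv.
have /nbhs_ballP[e /= e0 eU] : nbhs (T (Num.max t 0) v) U by exact: open_nbhs_nbhs.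
have e2 : 0 < e / 2 by rewrite divr_gt0.
have t0 : `[0, +oo[%classic (Num.max t 0) by rewrite /= in_itv/= max0_ge0.
have /subspace_continuousP/(_ _ t0) cT := @hTcont v.
have /nbhs_ballP[d /= d0 dT] := cT _ (nbhsx_ballx (T (Num.max t 0) v) _ e2).
exists (Num.min d (e / 2)); first by rewrite lt_min d0.
move=> t' v'; rewrite -!ball_normE /= => tt' vv'.
apply: eU; rewrite -ball_normE /=.
rewrite (_ : T _ v - _ = (T (Num.max t 0) v - T (Num.max t' 0) v) +
   (T (Num.max t' 0) v - T (Num.max t' 0) v')); last by rewrite addrA subrK.
apply: (le_lt_trans (ler_normD _ _)); rewrite (splitr e); apply: ltr_leD.
  have : ball (T (Num.max t 0) v) (e / 2) (T (Num.max t' 0) v).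
    apply: dT; last by rewrite /= in_itv/= max0_ge0.
    rewrite -ball_normE /=; apply: (@le_lt_trans _ _ `|t - t'|).
      have h1 := ler_norm (t - t').
      have h2 : t' - t <= `|t - t'| by rewrite distrC ler_norm.
      have h3 := normr_ge0 (t - t').
      by rewrite ler_norml; case: (leP t 0) => ?; case: (leP t' 0) => ?;
        apply/andP; split; lra.
    by move: tt'; rewrite lt_min => /andP[].
  by rewrite -ball_normE.
apply: (le_trans (hTcontr _ _ (max0_ge0 _))).
by move: vv'; rewrite lt_min => /andP[_ /ltW].
Qed.

Lemma measurable_flow {d} {S : measurableType d} (f : S -> R) (g : S -> borel V) :
  measurable_fun setT f -> measurable_fun setT g ->
  measurable_fun setT (fun w => T (Num.max (f w) 0) (g w) : borel V).
Proof.
move=> mf mg; apply: measurable_to_borel => U oU.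
have [sR dR] := @dense_sequence_real R.
have [sV dV] := dense_sequence hVsep.
apply: (@measurable_preimage_continuous2 _ _ _ _ _ _ _ _ dR dV f g
    (fun t v => T (Num.max t 0) v)).
- move=> a e; rewrite -[X in measurable X]setTI; apply: mf => //.
  by apply: open_measurable; exact: ball_open.
- move=> b e; apply: measurable_preimage_open => //.
  exact: (@ball_open R V).
- by move=> a b; exact: flow_continuous2.
Qed.

Lemma measurable_addV {d} {S : measurableType d} (f g : S -> borel V) :
  measurable_fun setT f -> measurable_fun setT g ->
  measurable_fun setT (fun w => (f w : V) + (g w : V) : borel V).
Proof.
move=> mf mg; apply: measurable_to_borel => U oU.
have [sV dV] := dense_sequence hVsep.
apply: (@measurable_preimage_continuous2 _ _ _ _ _ _ _ _ dV dV f g (fun a b => a + b)).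
- by move=> b e; apply: measurable_preimage_open => //; exact: (@ball_open R V).
- by move=> b e; apply: measurable_preimage_open => //; exact: (@ball_open R V).
- move=> a b Uab.
  have /nbhs_ballP[e /= e0 eU] : nbhs (a + b) U by exact: open_nbhs_nbhs.
  exists (e / 2); first by rewrite divr_gt0.
  move=> a' b'; rewrite -!ball_normE /= => aa' bb'.
  apply: eU; rewrite -ball_normE /= opprD addrACA (splitr e).
  by apply: (le_lt_trans (ler_normD _ _)); exact: ltrD.
Qed.

(** All starting points are forgotten, uniformly over the whole space. The
decay in [W] enters the proof only through this property. *)
Definition coalescing (S : R -> V -> V) := forall e, 0 < e ->
  exists2 r, 0 < r & forall t v w, r <= t -> `|S t v - S t w| <= e.

(** The bound [(kappa t + d `^ (- rho^-1)) `^ (- rho)] is at most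
[(kappa t) `^ (- rho)], whatever the distance [d] of the starting points in [W].
It passes to the norm of [V] because the injection is bounded, and to all
starting points in [V] by density and contractivity. *)
Lemma coalescing_of_decay (W : completeNormedModType R) (iota : {linear W -> V})
  (hiota_cont : continuous iota) (hiota_dense : dense (range iota))
  (hTW : forall (t : R) (w : W), 0 <= t -> range iota (T t (iota w)))
  (kappa rho : R) (hkappa : 0 < kappa) (hrho : 0 < rho)
  (hTWdecay : forall (t : R) (w1 w2 u1 u2 : W), 0 <= t ->
     iota u1 = T t (iota w1) -> iota u2 = T t (iota w2) ->
     `|u1 - u2| <=
       if w1 == w2 then 0
       else (kappa * t + `|w1 - w2| `^ (- rho^-1)) `^ (- rho)) :
  coalescing T.
Proof.
move=> e e0.
have /linear_boundedP[M [_ HM]] : bounded_near iota (nbhs (0 : W)).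
  by apply: continuous_linear_bounded; exact: hiota_cont.
pose C := Num.max (M + 1) 1.
have C0 : 0 < C by rewrite lt_max ltr01 orbT.
have hC w : `|iota w| <= C * `|w|.
  by apply: HM; rewrite lt_max ltrDl ltr01.
pose a := e / (2 * C).
have a0 : 0 < a by rewrite divr_gt0// mulr_gt0.
pose r := (a `^ (rho^-1))^-1 / kappa.
have r0 : 0 < r by rewrite divr_gt0// invr_gt0 powR_gt0.
exists r => // t v w rt.
have t0 : 0 <= t by rewrite (le_trans (ltW r0)).
(* the W-norm bound loses all memory of the distance of the starting points *)
have decW w1 w2 : `|T t (iota w1) - T t (iota w2)| <= e / 2.
  have [u1 _ h1] := hTW t w1 t0; have [u2 _ h2] := hTW t w2 t0.
  rewrite -h1 -h2 -linearB; apply: (le_trans (hC _)).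
  rewrite -ler_pdivlMl//.
  have -> : C^-1 * (e / 2) = a by rewrite /a invfM; ring.
  apply: (le_trans (hTWdecay _ _ _ _ _ t0 h1 h2)); case: ifPn => _; first exact: ltW.
  rewrite powRN -[leRHS]invrK lef_pV2 ?posrE ?invr_gt0 ?powR_gt0//; last first.
    by rewrite ltr_wpDr ?powR_ge0// mulr_gt0// (lt_le_trans r0).
  have -> : a^-1 = (a `^ (rho^-1))^-1 `^ rho.
    by rewrite -powRN -powRrM mulNr mulVf ?gt_eqF// powR_inv1 ?ltW.
  apply: ge0_ler_powR; rewrite ?nnegrE ?invr_ge0 ?powR_ge0 ?(ltW hrho)//.
    by rewrite addr_ge0 ?powR_ge0// mulr_ge0// ltW.
  have : (a `^ (rho^-1))^-1 <= kappa * t.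
    by rewrite -ler_pdivrMl// mulrC.
  by move/le_trans; apply; rewrite lerDl powR_ge0.
have app (z : V) : exists w0, `|z - iota w0| <= e / 4.
  have e4 : 0 < e / 4 by rewrite divr_gt0.
  have : ball z (e / 4) !=set0 by exists z; exact: ballxx.
  move=> /hiota_dense/(_ (ball_open _ _)) -[y [zy [w0 _ w0y]]].
  exists w0; rewrite w0y; apply: ltW.
  by move: zy; rewrite -ball_normE.
have [w1 h1] := app v; have [w2 h2] := app w.
rewrite (_ : T t v - T t w = (T t v - T t (iota w1)) +
  (T t (iota w1) - T t (iota w2)) + (T t (iota w2) - T t w)); last first.
  by rewrite !addrA !subrK.
apply: (le_trans (ler_normD _ _)).
have := ler_normD (T t v - T t (iota w1)) (T t (iota w1) - T t (iota w2)).
have := decW w1 w2.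
have := le_trans (hTcontr v (iota w1) t0) h1.
have := hTcontr (iota w2) w t0; rewrite [X in _ <= X -> _]distrC => /le_trans /(_ h2).
lra.
Qed.

End ContractiveFlow.

(** * The chain, the process and its time integrals, path by path *)

(** The chain driven by this flow is a functional of the noise after the last
inter-arrival time of length at least [r]. *)
Definition reset_flow {R : realType} {V : completeNormedModType R}
  (T : R -> V -> V) (r : R) : R -> V -> V := fun t v => if t < r then T t v else 0.

(** The quantification over all measurable spaces lets one lemma on chains serve
for the noise, for its sub-sigma-algebras and for products with time or space. *)
Definition jointly_measurable {R : realType} {V : completeNormedModType R}
    (F : R -> V -> V) :=
  forall (d : measure_display) (S : measurableType d) (f : S -> R) (g : S -> borel V),
  (forall w, 0 <= f w) -> measurable_fun setT f -> measurable_fun setT g ->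
  measurable_fun setT (fun w => F (f w) (g w) : borel V).

Section Chain.
Context {R : realType} {V : completeNormedModType R}.

Lemma chain_comp (F : R -> V -> V) {S S' : Type} (phi : S' -> S)
    (eta : nat -> S -> V) (beta : nat -> S -> R) (x : S' -> V) m w :
  chain F (fun k w => eta k (phi w)) (fun k w => beta k (phi w)) x m w =
  chain F eta beta (cst (x w)) m (phi w).
Proof. by elim: m => //= m ->. Qed.

Lemma chainD (F : R -> V -> V) {S : Type} (eta : nat -> S -> V)
    (beta : nat -> S -> R) (x : S -> V) i k w :
  chain F eta beta x (i + k) w =
  chain F (fun l => eta (i + l)%N) (fun l => beta (i + l)%N) (chain F eta beta x i) k w.
Proof. by elim: k => [|k IH]; rewrite ?addn0// addnS /= IH. Qed.

Lemma measurable_chain (F : R -> V -> V) {d} {S : measurableType d}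
    (eta : nat -> S -> borel V) (beta : nat -> S -> R) (x : S -> borel V) m :
  separable_space V -> jointly_measurable F ->
  (forall k w, 0 < beta k w) ->
  (forall k, (k < m)%N -> measurable_fun setT (eta k)) ->
  (forall k, (k < m)%N -> measurable_fun setT (beta k)) ->
  measurable_fun setT x ->
  measurable_fun setT (chain F eta beta x m : S -> borel V).
Proof.
move=> sV mF b0 + + mx; elim: m => [//|m IH] me mb /=.
apply: (measurable_addV sV); last by apply: me.
apply: mF => [w||]; [exact: ltW|exact: mb|].
by apply: IH => k km; [apply: me|apply: mb]; exact: ltnW.
Qed.

End Chain.

Section Paths.
Context {R : realType} {V : completeNormedModType R} (T : R -> V -> V).
Hypotheses (hVsep : separable_space V)
  (hTcont : time_continuous T) (hTcontr : contractive T)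
  (hT0 : forall t : R, 0 <= t -> T t 0 = 0).

Lemma jointly_measurable_flow : jointly_measurable T.
Proof.
move=> d S f g f0 mf mg.
have -> : (fun w => T (f w) (g w) : borel V) = (fun w => T (Num.max (f w) 0) (g w)).
  by apply/funext => w; rewrite max_l.
exact: measurable_flow.
Qed.

Lemma jointly_measurable_reset r : jointly_measurable (reset_flow T r).
Proof.
move=> d S f g f0 mf mg; rewrite /reset_flow.
apply: measurable_fun_ifT => //; first exact: measurable_fun_ltr.
exact: jointly_measurable_flow.
Qed.

Section OnePath.
Context {S : Type}.
Variables (eta : nat -> S -> V) (beta : nat -> S -> R).
Hypothesis beta0 : forall k w, 0 < beta k w.

Lemma arrival0 w : arrival beta 0 w = 0.
Proof. by rewrite /arrival big_ord0. Qed.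

Lemma arrivalS m w : arrival beta m.+1 w = arrival beta m w + beta m w.
Proof. by rewrite /arrival big_ord_recr. Qed.

Lemma arrival_ge0 m w : 0 <= arrival beta m w.
Proof. by apply: sumr_ge0 => i _; exact: ltW. Qed.

Lemma arrival_mono w : {homo (fun m => arrival beta m w) : m n / (m <= n)%N >-> m <= n}.
Proof.
apply: homo_leq => [//||m]; first exact: le_trans.
by rewrite arrivalS lerDl ltW.
Qed.

Lemma arrival_interval_inj w t m n :
  arrival beta m w <= t < arrival beta m.+1 w ->
  arrival beta n w <= t < arrival beta n.+1 w -> m = n.
Proof.
move=> /andP[a b] /andP[a' b']; apply/eqP; rewrite eqn_leq.
apply/andP; split; rewrite leqNgt; apply/negP => /(arrival_mono w) h.
  by move: (lt_le_trans b' (le_trans h a)); rewrite ltxx.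
by move: (lt_le_trans b (le_trans h a')); rewrite ltxx.
Qed.

Lemma arrival_interval w t : 0 <= t -> (exists n, t < arrival beta n w) ->
  exists m, arrival beta m w <= t < arrival beta m.+1 w.
Proof.
move=> t0 ex; have [n tn nmin] := ex_minnP ex.
case: n tn nmin => [|m] tm mmin; first by move: tm; rewrite arrival0 ltNge t0.
exists m; rewrite tm andbT leNgt; apply/negP => /mmin.
by rewrite ltnn.
Qed.

Lemma processE x t w m : arrival beta m w <= t < arrival beta m.+1 w ->
  process T eta beta x t w = T (t - arrival beta m w) (chain T eta beta x m w).
Proof.
move=> tm; rewrite /process; apply: norm_lim_near_cst.
exists m.+1 => // n /= mn; rewrite /series /=.
rewrite big_mkord (bigD1 (Ordinal mn))//= big1 ?addr0.
  rewrite indicE mem_set/=; last by rewrite in_itv.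
  by rewrite scale1r max_l// subr_ge0; case/andP: tm.
move=> i im; rewrite indicE memNset ?scale0r//= in_itv /= => ti.
by move: im; rewrite -val_eqE /= (arrival_interval_inj ti tm) eqxx.
Qed.

Lemma process_out x t w : (forall m, ~~ (arrival beta m w <= t < arrival beta m.+1 w)) ->
  process T eta beta x t w = 0.
Proof.
move=> tm; rewrite /process; apply: norm_lim_near_cst.
apply: nearW => n; rewrite /series /= big1// => i _.
by rewrite indicE memNset ?scale0r//= in_itv /=; apply/negP.
Qed.

Lemma process_comp (S' : Type) (phi : S' -> S) x (t : S' -> R) w :
  process T (fun k w => eta k (phi w)) (fun k w => beta k (phi w)) x (t w) w =
  process T eta beta (cst (x w)) (t w) (phi w).
Proof.
rewrite /process; congr (limn (series _)); apply/funext => m.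
by rewrite /= chain_comp.
Qed.

End OnePath.

(** At most one term of the series defining the process is nonzero, and none is
at a time that no interval between successive arrivals contains. *)
Lemma measurable_process {d} {S : measurableType d}
    (eta : nat -> S -> borel V) (beta : nat -> S -> R) (x : S -> borel V) (t : S -> R) :
  (forall k w, 0 < beta k w) ->
  (forall k, measurable_fun setT (eta k)) ->
  (forall k, measurable_fun setT (beta k)) ->
  measurable_fun setT x -> measurable_fun setT t ->
  measurable_fun setT (fun w => process T eta beta x (t w) w : borel V).
Proof.
move=> b0 me mb mx mt _ B mB; rewrite setTI.
have ma m : measurable_fun setT (arrival beta m).
  by rewrite /arrival; apply: measurable_sum.
pose I m := [set w | arrival beta m w <= t w < arrival beta m.+1 w].
have mI m : measurable (I m).
  have : measurable_fun setT (fun w => (arrival beta m w <= t w) && (t w < arrival beta m.+1 w)).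
    by apply: measurable_and; [exact: measurable_fun_ler|exact: measurable_fun_ltr].
  by move=> /(_ measurableT [set true]); rewrite setTI; apply.
pose f m w : borel V := T (Num.max (t w - arrival beta m w) 0) (chain T eta beta x m w).
have mf m : measurable_fun setT (f m).
  apply: (measurable_flow hVsep hTcont hTcontr); first exact: measurable_funB.
  by apply: measurable_chain => //; exact: jointly_measurable_flow.
have -> : (fun w => process T eta beta x (t w) w : borel V) @^-1` B =
   \bigcup_m (I m `&` f m @^-1` B) `|`
   ((\bigcap_m ~` I m) `&` (cst (0 : borel V) : S -> borel V) @^-1` B).
  apply/seteqP; split => [w /= Bw|w].
    have [[m tm]|/forallNP h] := pselect (exists m, I m w).
      left; exists m => //; split=> //; rewrite /= /f.
      move: Bw; rewrite (processE _ b0 _ tm) max_l//.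
      by case/andP: tm; rewrite subr_ge0.
    right; split => [m _|/=]; first exact: h.
    by move: Bw; rewrite process_out// => m; apply/negP; exact: h.
  move=> [[m _ [tm]]|[h]] /=.
    by rewrite (processE _ b0 _ tm) /f max_l//; case/andP: tm; rewrite subr_ge0.
  by rewrite process_out// => m; apply/negP; exact: (h m).
apply: measurableU.
  apply: bigcup_measurable => m _; apply: measurableI => //.
  by rewrite -[X in measurable X]setTI; exact: mf.
apply: measurableI; first by apply: bigcap_measurable => // m _; exact: measurableC.
by rewrite -[X in measurable X]setTI; apply: measurable_cst.
Qed.

End Paths.

Definition lip_bound {R : realType} {V : completeNormedModType R} (L : R) (psi : V -> R) :=
  forall v w, `|psi v - psi w| <= L * `|v - w|.

(** Time is clipped at 0 to make the integrand continuous on the whole line. *)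
Definition leg {R : realType} {V : completeNormedModType R} (T : R -> V -> V)
    (psi : V -> R) (s : R) (v : V) : R :=
  \int[lebesgue_measure]_(u in `[0, s]) psi (T (Num.max u 0) v).

Section Legs.
Context {R : realType} {V : completeNormedModType R} (T : R -> V -> V).
Hypotheses (hVsep : separable_space V)
  (hTcont : time_continuous T) (hTcontr : contractive T)
  (hT0 : forall t : R, 0 <= t -> T t 0 = 0).
Variables (psi : V -> R) (L : R).
Hypothesis hpsi : lip_bound L psi.
Notation mu := (@lebesgue_measure R).

Lemma lip_bound_continuous : continuous psi.
Proof.
move=> v; apply/cvgrPdist_lt => e e0.
have L1 : 0 < `|L| + 1 by rewrite ltr_pwDr.
have h : 0 < e / (`|L| + 1) by rewrite divr_gt0.
near=> w.
apply: (le_lt_trans (hpsi _ _)).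
apply: (@le_lt_trans _ _ ((`|L| + 1) * `|v - w|)).
  by rewrite ler_wpM2r// (le_trans (ler_norm _))// lerDl.
rewrite -ltr_pdivlMl// mulrC; near: w.
have := nbhsx_ballx v _ h; rewrite -ball_normE; exact.
Unshelve. all: by end_near. Qed.

Lemma flow_continuous_time v : continuous (fun u : R => T (Num.max u 0) v).
Proof.
move=> u U /nbhs_ballP[e /= e0 eU].
have [d d0 h] := flow_continuous2 hTcont hTcontr (ball_open (T (Num.max u 0) v) e)
  (ballxx _ e0).
by apply/nbhs_ballP; exists d => // u' uu'; apply/eU/h => //; exact: ballxx.
Qed.

Lemma psi_flow_continuous v : continuous (fun u : R => psi (T (Num.max u 0) v)).
Proof.
move=> u; apply: (@continuous_comp _ _ _ (fun u : R => T (Num.max u 0) v) psi).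
  exact: flow_continuous_time.
exact: lip_bound_continuous.
Qed.

Lemma integrable_leg v a b : mu.-integrable `[a, b] (EFin \o (fun u => psi (T (Num.max u 0) v))).
Proof.
apply: continuous_compact_integrable; first exact: segment_compact.
exact/continuous_subspaceT/psi_flow_continuous.
Qed.

Lemma Rintegral_itv_cst (s c : R) : 0 <= s -> \int[mu]_(u in `[0, s]) c = s * c.
Proof.
move=> s0; rewrite /Rintegral integral_cst//= lebesgue_measure_itv /= lte_fin.
case: ltgtP s0 => // [s0 _|<- _]; last by rewrite mule0 mul0r.
by rewrite oppr0 adde0 -EFinM /= mulrC.
Qed.

Lemma integrable_itv_cst (c a b : R) : mu.-integrable `[a, b] (EFin \o cst c).
Proof.
apply: continuous_compact_integrable; first exact: segment_compact.
by apply: continuous_subspaceT => x; exact: cvg_cst.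
Qed.

Lemma leg_le s v B : 0 <= s -> (forall u, 0 <= u -> psi (T u v) <= B) ->
  leg T psi s v <= s * B.
Proof.
move=> s0 hB; rewrite -Rintegral_itv_cst//; apply: le_Rintegral => //.
- exact: integrable_leg.
- exact: integrable_itv_cst.
- by move=> u _ /=; apply: hB; exact: max0_ge0.
Qed.

Lemma leg_ge0 s v : (forall v, 0 <= psi v) -> 0 <= leg T psi s v.
Proof. by move=> p0; apply: Rintegral_ge0. Qed.

Lemma leg_lip s v w : 0 <= s -> 0 <= L ->
  `|leg T psi s v - leg T psi s w| <= s * (L * `|v - w|).
Proof.
move=> s0 L0; rewrite /leg -RintegralB//; last 2 first.
- exact: integrable_leg.
- exact: integrable_leg.
apply: (le_trans (le_normr_Rintegral _ _)) => //.
  have := integrableB _ (integrable_leg v 0 s) (integrable_leg w 0 s); apply => //.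
rewrite -(Rintegral_itv_cst (L * `|v - w|) s0); apply: le_Rintegral => //.
- have := integrableB _ (integrable_leg v 0 s) (integrable_leg w 0 s).
  by move=> /(_ (measurable_itv _)) /integrable_norm; apply.
- exact: integrable_itv_cst.
- move=> u _ /=; apply: (le_trans (hpsi _ _)); apply: ler_wpM2l => //.
  exact/hTcontr/max0_ge0.
Qed.

Lemma measurable_leg {d} {S : measurableType d} (f : S -> R) (g : S -> borel V) :
  (forall v, 0 <= psi v) ->
  measurable_fun setT f -> measurable_fun setT g ->
  measurable_fun setT (fun w => leg T psi (f w) (g w)).
Proof.
move=> p0 mf mg.
pose h (z : S * R) : \bar R :=
  ((if 0 <= z.2 <= f z.1 then psi (T (Num.max z.2 0) (g z.1)) else 0)%:E)%E.
have mh : measurable_fun setT h.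
  apply/measurable_EFinP; apply: measurable_fun_ifT => //.
    apply: measurable_and; first exact: measurable_fun_ler.
    by apply: measurable_fun_ler => //; exact: measurableT_comp.
  apply: (@measurable_continuous_borel _ _ _ V); last exact: lip_bound_continuous.
  apply: (measurable_flow hVsep hTcont hTcontr) => //.
  exact: measurableT_comp.
have h0 z : (0 <= h z)%E by rewrite /h lee_fin; case: ifP.
have := measurable_fun_fubini_tonelli_F (m2 := mu) _ mh h0.
have -> : (fun w => leg T psi (f w) (g w)) = fine \o fubini_F mu h.
  apply/funext => w /=; rewrite /leg /Rintegral /fubini_F; congr fine.
  rewrite integral_mkcond; apply: eq_integral => u _.
  rewrite /h patchE mem_setE in_itv /=; case: ifP => //.
by move=> mF; apply: measurableT_comp mF.
Qed.

End Legs.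

Section PathIntegral.
Context {R : realType} {V : completeNormedModType R} (T : R -> V -> V).
Hypotheses (hVsep : separable_space V)
  (hTcont : time_continuous T) (hTcontr : contractive T)
  (hT0 : forall t : R, 0 <= t -> T t 0 = 0).
Notation mu := (@lebesgue_measure R).

Lemma Rintegral_shift (G : R -> R) (a s : R) : 0 <= s -> continuous G ->
  \int[mu]_(t in `[a, a + s]) G (t - a) = \int[mu]_(u in `[0, s]) G u.
Proof.
move=> s0 cG; rewrite /Rintegral; congr fine.
pose F := fun x : R => x + a.
have dF (x : R) : is_derive x 1 F 1.
  by rewrite /F -[X in is_derive _ _ _ X]addr0; apply: is_deriveD.
have F' : F^`()%classic = cst 1.
  by apply/funext => x; rewrite derive1E; apply: derive_val.
have cF : continuous F by move=> x; apply: cvgD; [exact: cvg_id|exact: cvg_cst].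
have := @integration_by_substitution_increasing R F (fun y => G (y - a)) 0 s s0.
have -> : F 0 = a by rewrite /F add0r.
have -> : F s = a + s by rewrite /F addrC.
rewrite F' => ->.
- by apply: eq_integral => u _; congr EFin; rewrite mulrfctE /= /F addrK mulr1.
- by move=> x y _ _; rewrite ltrD2r.
- by move=> x _; exact: cvg_cst.
- exact: is_cvg_cst.
- exact: is_cvg_cst.
- split; first by move=> x _; exact: (@ex_derive _ _ _ _ _ _ _ (dF x)).
  + exact/cvg_at_right_filter/cF.
  + exact/cvg_at_left_filter/cF.
- apply: continuous_subspaceT => x.
  apply: (@continuous_comp _ _ _ (fun y : R => y - a) G); last exact: cG.
  by apply: cvgB; [exact: cvg_id|exact: cvg_cst].
Qed.

Section Path.
Context {S : Type}.
Variables (eta : nat -> S -> V) (beta : nat -> S -> R).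
Hypothesis beta0 : forall k w, 0 < beta k w.
Variables (psi : V -> R) (L : R).
Hypothesis hpsi : lip_bound L psi.
Variables (x : S -> V) (w : S).
Local Notation X := (fun t => process T eta beta x t w).
Local Notation alpha m := (arrival beta m w).

Lemma measurable_path : measurable_fun setT (fun t : R => psi (X t)).
Proof.
apply: (@measurable_continuous_borel _ _ _ V X); last exact: (lip_bound_continuous hpsi).
rewrite (_ : X = fun t => process T (fun k (_ : R) => eta k w) (fun k (_ : R) => beta k w)
                            (cst (x w)) t t).
  apply: (measurable_process hVsep hTcont hTcontr) => // k; exact: measurable_cst.
apply/funext => t; rewrite (process_comp T eta beta (fun _ : R => w) (cst (x w)) id).
by rewrite -(process_comp T eta beta (fun w : S => w) x (cst t)).
Qed.

Lemma path_norm_le t n : 0 <= t -> t < alpha n ->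
  `|X t| <= \sum_(m < n) `|chain T eta beta x m w|.
Proof.
move=> t0 tn; have [m tm] := arrival_interval t0 (ex_intro _ n tn).
have mn : (m < n)%N.
  rewrite ltnNge; apply/negP => /(arrival_mono beta0 w) /(lt_le_trans tn).
  by case/andP: tm => + _; rewrite leNgt => /negP.
rewrite (processE _ _ beta0 _ tm).
apply: (le_trans (flow_norm_le hTcontr hT0 _ _)); first by rewrite subr_ge0; case/andP: tm.
by rewrite (bigD1 (Ordinal mn))//= lerDl sumr_ge0.
Qed.

Lemma integrable_path t n : t < alpha n -> mu.-integrable `[0, t] (EFin \o (fun t => psi (X t))).
Proof.
move=> tn; apply: measurable_bounded_integrable => //.
- by rewrite /= lebesgue_measure_itv /=; case: ifP => // _; rewrite -EFinB ltry.
- by apply: measurable_funTS; exact: measurable_path.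
pose M := `|psi 0| + `|L| * \sum_(m < n) `|chain T eta beta x m w|.
exists M; split; first exact: num_real.
move=> N MN u; rewrite /= in_itv /= => /andP[u0 ut].
apply: le_trans (ltW MN); rewrite -[psi _](subrK (psi 0)).
apply: (le_trans (ler_normD _ _)); rewrite addrC /M lerD2l.
apply: (le_trans (hpsi _ _)); rewrite subr0.
apply: (le_trans (ler_wpM2r (normr_ge0 _) (ler_norm L))).
apply: ler_wpM2l => //; apply: path_norm_le => //; exact: le_lt_trans tn.
Qed.

Lemma path_integralB s t n : 0 <= s -> s <= t -> t < alpha n ->
  \int[mu]_(u in `[0, t]) psi (X u) - \int[mu]_(u in `[0, s]) psi (X u) =
  \int[mu]_(u in `]s, t]) psi (X u).
Proof.
move=> s0 st tn; rewrite Rintegral_itvB//; exact: integrable_path tn.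
Qed.

(** Between arrivals the process follows the flow, so its time integral up to
an arrival is the sum of the integrals over the legs. *)
Lemma path_integral_arrival n :
  \int[mu]_(u in `[0, alpha n]) psi (X u) =
  \sum_(m < n) leg T psi (beta m w) (chain T eta beta x m w).
Proof.
elim: n => [|n IH].
  rewrite big_ord0 arrival0 set_itv1 /Rintegral integral_set1//=.
have lt m : alpha m < alpha m.+1 by rewrite arrivalS ltrDl.
rewrite big_ord_recr /= -IH.
have := path_integralB (arrival_ge0 beta0 n w) (ltW (lt n)) (lt n.+1).
move/eqP; rewrite subr_eq => /eqP ->; rewrite addrC; congr (_ + _).
rewrite /leg -(Rintegral_shift (alpha n) (ltW (beta0 n w))
  (@psi_flow_continuous _ _ _ hTcont hTcontr _ _ hpsi _)) -arrivalS.
have iX : mu.-integrable `[alpha n, alpha n.+1] (EFin \o (fun t => psi (X t))).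
  apply: integrableS (integrable_path (lt n.+1)) => //.
  by apply: subset_itvr; rewrite bnd_simp arrival_ge0.
have iG : mu.-integrable `[alpha n, alpha n.+1] (EFin \o (fun t => psi
    (T (Num.max (t - alpha n) 0) (chain T eta beta x n w)))).
  apply: continuous_compact_integrable; first exact: segment_compact.
  apply: continuous_subspaceT => t.
  apply: (@continuous_comp _ _ _ (fun y : R => y - alpha n)
    (fun u : R => psi (T (Num.max u 0) (chain T eta beta x n w)))).
    by apply: cvgB; [exact: cvg_id|exact: cvg_cst].
  exact: (psi_flow_continuous hTcont hTcontr hpsi).
rewrite Rintegral_itv_obnd_cbnd; last first.
  by apply: integrableS iX => //; apply: subset_itvr; rewrite bnd_simp.
rewrite -Rintegral_itv_bndo_bndc; last first.
  by apply: integrableS iX => //; apply: subset_itvl; rewrite bnd_simp.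
rewrite -[RHS]Rintegral_itv_bndo_bndc; last first.
  by apply: integrableS iG => //; apply: subset_itvl; rewrite bnd_simp.
apply: eq_Rintegral => t; rewrite inE /= in_itv /= => tn.
by rewrite (processE _ _ beta0 _ tn) max_l// subr_ge0; case/andP: tn.
Qed.

End Path.
End PathIntegral.

(** * Independence of the past and the future of the noise *)

Section Independence.
Context {d : measure_display} {Omega : measurableType d} {R : realType}.
Variable P : probability Omega R.
Local Open Scope ereal_scope.

(** Both sides are finite measures in [A] that agree on a pi-system. *)
Lemma independent_set_pi (G : set (set Omega)) (B : set Omega) :
  G `<=` measurable -> setI_closed G -> G setT -> measurable B ->
  (forall A, G A -> P (A `&` B) = P A * P B) ->
  forall A, <<s G >> A -> P (A `&` B) = P A * P B.
Proof.
move=> mG IG GT mB ind A sA.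
pose r : {nonneg R} := NngNum (fine_ge0 (measure_ge0 P B)).
have rE : (r%:num)%:E = P B by rewrite /= fineK// fin_num_measure.
have : mrestr P mB A = mscale r P A.
  apply: (@g_sigma_algebra_measure_unique _ R Omega G mG (fun=> setT) (fun=> GT) _
    (mrestr P mB) (mscale r P) IG _ _ A sA).
  - by rewrite bigcup_const.
  - by move=> E GE; rewrite -[LHS]/(P (E `&` B)) -[RHS]/((r%:num)%:E * P E) rE muleC ind.
  - by move=> _; rewrite -[X in X < _]/(P (setT `&` B)) ltey_eq fin_num_measure// setTI.
by rewrite -[mrestr _ _ _]/(P (A `&` B)) -[mscale _ _ _]/((r%:num)%:E * P A) rE muleC.
Qed.

Lemma independent2_pi (G H : set (set Omega)) :
  G `<=` measurable -> setI_closed G -> G setT ->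
  H `<=` measurable -> setI_closed H -> H setT ->
  (forall A B, G A -> H B -> P (A `&` B) = P A * P B) ->
  independent2 P <<s G >> <<s H >>.
Proof.
move=> mG IG GT mH IH HT ind A B sA sB.
have mA : measurable A.
  by apply: (smallest_sub _ mG) sA; exact: sigma_algebra_measurable.
rewrite setIC muleC; move: sB.
apply: independent_set_pi => // C HC; rewrite setIC muleC; move: sA.
by apply: independent_set_pi => //; [exact: mH|move=> E GE; exact: ind].
Qed.

(** The pair of two independent variables has the product law, so the mean of
a product is computed by Tonelli's theorem. *)
Lemma integral_mul_independent (F G : set (set Omega)) (f g : Omega -> R) :
  independent2 P F G ->
  measurable_fun setT f -> measurable_fun setT g ->
  (forall B, measurable B -> F (f @^-1` B)) ->
  (forall B, measurable B -> G (g @^-1` B)) ->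
  (forall w, 0 <= f w)%R -> (forall w, 0 <= g w)%R ->
  \int[P]_w (f w * g w)%:E = (\int[P]_w (f w)%:E) * (\int[P]_w (g w)%:E).
Proof.
move=> ind mf mg Ff Gg f0 g0.
pose X : {RV P >-> R} := mfun_Sub (mem_set mf).
pose Y : {RV P >-> R} := mfun_Sub (mem_set mg).
have mXY : measurable_fun setT (fun w => (f w, g w)) by exact: measurable_fun_pair.
pose Z : {RV P >-> (R * R)%type} := mfun_Sub (mem_set mXY).
have law (E : set (R * R)) : measurable E ->
    distribution P Z E = (distribution P X \x distribution P Y) E.
  move=> mE; apply/esym; apply: product_measure_unique => // A B mA mB.
  rewrite /distribution /pushforward /=.
  rewrite -(ind _ _ (Ff _ mA) (Gg _ mB)).
by congr (P _); apply/seteqP; split => w.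
pose h (z : R * R) : \bar R := `|z.1|%:E * `|z.2|%:E.
have m1 : measurable_fun setT (fun z : R * R => `|z.1|%:E).
  by apply/measurable_EFinP; exact: (@measurableT_comp _ _ _ _ _ _ (@Num.norm _ R) _ fst).
have m2 : measurable_fun setT (fun z : R * R => `|z.2|%:E).
  by apply/measurable_EFinP; exact: (@measurableT_comp _ _ _ _ _ _ (@Num.norm _ R) _ snd).
have mh : measurable_fun setT h.
  exact: emeasurable_funM.
have h0 z : 0 <= h z by rewrite mule_ge0// lee_fin normr_ge0.
transitivity (\int[distribution P Z]_z h z).
  rewrite (@ge0_integral_distribution _ _ _ _ _ _ Z h)//.
  by apply: eq_integral => w _; rewrite /h /= !ger0_norm.
rewrite (eq_measure_integral (distribution P X \x distribution P Y)); last first.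
  by move=> A mA _; exact: law.
rewrite fubini_tonelli1//= /fubini_F /h /=.
have mnR : measurable_fun setT (fun z : R => `|z|%:E).
  by apply/measurable_EFinP; exact: (@measurableT_comp _ _ _ _ _ _ (@Num.norm _ R) _ id).
transitivity (\int[distribution P X]_x (`|x|%:E * \int[distribution P Y]_y `|y|%:E)).
  by apply: eq_integral => x _; rewrite ge0_integralZl.
rewrite ge0_integralZr//; last by apply: integral_ge0.
congr (_ * _); rewrite ge0_integral_distribution//.
  by apply: eq_integral => w _; rewrite /= ger0_norm.
by apply: eq_integral => w _; rewrite /= ger0_norm.
Qed.

Context {V : completeNormedModType R}.
Variables (eta : nat -> {RV P >-> borel V}) (beta : nat -> {RV P >-> R}).
Hypotheses (heta_indep : independent_rvs P eta) (hbeta_indep : independent_rvs P beta)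
  (heta_beta : independent2 P (sigma_seq eta) (sigma_seq beta)).

Definition noise_sigma (I : set nat) : set (set Omega) :=
  <<s \bigcup_(k in I) (sigma_rv (eta k) `|` sigma_rv (beta k)) >>.

Lemma sigma_rvT {d'} {S : measurableType d'} (X : Omega -> S) : sigma_rv X setT.
Proof. by exists setT => //; rewrite setTI preimage_setT. Qed.

Lemma sigma_rvI {d'} {S : measurableType d'} (X : Omega -> S) A B :
  sigma_rv X A -> sigma_rv X B -> sigma_rv X (A `&` B).
Proof.
move=> [A' mA <-] [B' mB <-]; exists (A' `&` B'); first exact: measurableI.
by rewrite !setTI preimage_setI.
Qed.

Lemma sigma_rv_measurable {d'} {S : measurableType d'} (X : {RV P >-> S}) A :
  sigma_rv X A -> measurable A.
Proof. by move=> [B mB <-]; exact: measurable_funP. Qed.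

Lemma sigma_seq_bigcap {d'} {S : measurableType d'} (X : nat -> Omega -> S)
    (A : nat -> set Omega) (J : {fset nat}) :
  (forall k, sigma_rv (X k) (A k)) -> sigma_seq X (\bigcap_(k in [set` J]) A k).
Proof.
move=> sA.
pose U := g_sigma_algebraType (\bigcup_m sigma_rv (X m)).
have : measurable (\bigcap_(k in [set` J]) (A k : set U)).
  apply: fin_bigcap_measurable => [|k _]; first exact: finite_fset.
  by apply: sub_sigma_algebra; exists k.
by [].
Qed.

(** Finitely supported rectangles of events of single noise variables with
indices in [I]: the pi-system on which independence is a product formula. *)
Definition rectangle (I : set nat) : set (set Omega) := [set E | exists N A B,
  [/\ forall k, sigma_rv (eta k) (A k), forall k, sigma_rv (beta k) (B k),
      forall k, ~ (I k /\ (k < N)%N) -> A k = setT /\ B k = setT &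
      E = \bigcap_k (A k `&` B k)]].

Lemma rectangle_measurable I : rectangle I `<=` measurable.
Proof.
move=> E [N [A [B [sA sB _ ->]]]]; apply: bigcapT_measurable => k.
by apply: measurableI; [exact: sigma_rv_measurable (sA k)|exact: sigma_rv_measurable (sB k)].
Qed.

Lemma rectangleI I : setI_closed (rectangle I).
Proof.
move=> _ _ [N [A [B [sA sB n1 ->]]]] [N' [A' [B' [sA' sB' n1' ->]]]].
exists (maxn N N'), (fun k => A k `&` A' k), (fun k => B k `&` B' k); split.
- by move=> k; exact: sigma_rvI.
- by move=> k; exact: sigma_rvI.
- move=> k hk; have [|-> ->] := n1 k.
    by move=> [Ik kN]; apply: hk; rewrite leq_max kN.
  have [|-> ->] := n1' k.
    by move=> [Ik kN]; apply: hk; rewrite leq_max kN orbT.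
  by rewrite setTI.
- by rewrite -bigcapI; apply: eq_bigcapr => k _; rewrite setIACA.
Qed.

Lemma rectangleT I : rectangle I setT.
Proof.
exists 0%N, (fun=> setT), (fun=> setT); split=> //.
- by move=> k; exact: sigma_rvT.
- by move=> k; exact: sigma_rvT.
- by rewrite bigcap_const// setTI.
Qed.

Lemma probability_rectangle N (A B : nat -> set Omega) :
  (forall k, sigma_rv (eta k) (A k)) -> (forall k, sigma_rv (beta k) (B k)) ->
  (forall k, (N <= k)%N -> A k = setT /\ B k = setT) ->
  P (\bigcap_k (A k `&` B k)) = \prod_(k <- [fset k in iota 0 N]%fset) (P (A k) * P (B k)).
Proof.
move=> sA sB nAB; set J := [fset k in iota 0 N]%fset.
have -> : \bigcap_k (A k `&` B k) =
    (\bigcap_(k in [set` J]) A k) `&` (\bigcap_(k in [set` J]) B k).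
  apply/seteqP; split => [w h|w [hA hB] k _].
    by split=> k _; have [] := h k I.
  have [kN|Nk] := ltnP k N; last by have [-> ->] := nAB k Nk.
  have kJ : [set` J] k by rewrite /= !inE mem_iota.
  by split; [exact: hA|exact: hB].
rewrite heta_beta; [|exact: sigma_seq_bigcap|exact: sigma_seq_bigcap].
by rewrite heta_indep// hbeta_indep// big_split.
Qed.

Lemma rectangle_independent I I' E E' : I `&` I' = set0 ->
  rectangle I E -> rectangle I' E' -> P (E `&` E') = P E * P E'.
Proof.
move=> II' [N [A [B [sA sB n1 ->]]]] [N' [A' [B' [sA' sB' n1' ->]]]].
rewrite -bigcapI; under eq_bigcapr do rewrite setIACA.
pose M := maxn N N'.
rewrite (@probability_rectangle M)//.
rewrite (@probability_rectangle M A)//.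
rewrite (@probability_rectangle M A')//.
- rewrite -big_split; apply: eq_bigr => k _ /=.
  have [Ik|nIk] := pselect (I k).
    have [|-> ->] := n1' k; last by rewrite !setIT probability_setT !mule1.
    by move=> [I'k _]; have : (I `&` I') k by []; rewrite II'.
  have [|-> ->] := n1 k; last by rewrite !setTI probability_setT !mul1e.
  by move=> [].
- by move=> k; rewrite geq_max => /andP[_ h]; apply: n1' => -[_]; rewrite ltnNge h.
- by move=> k; rewrite geq_max => /andP[h _]; apply: n1 => -[_]; rewrite ltnNge h.
- by move=> k; exact: sigma_rvI.
- by move=> k; exact: sigma_rvI.
- move=> k; rewrite geq_max => /andP[h h'].
  have [|-> ->] := n1 k; first by move=> -[_]; rewrite ltnNge h.
  have [|-> ->] := n1' k; first by move=> -[_]; rewrite ltnNge h'.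
  by rewrite setTI.
Qed.

Lemma noise_sigma_rectangle I : noise_sigma I `<=` <<s rectangle I >>.
Proof.
apply: smallest_sub; first exact: smallest_sigma_algebra.
move=> E [k Ik hE]; apply: sub_sigma_algebra.
have one (Q : nat -> set Omega) : \bigcap_j (if j == k then Q j else setT) = Q k.
  apply/seteqP; split => [w /(_ k Logic.I)|w Qw j _]; first by rewrite eqxx.
  by case: eqP => // ->.
case: hE => hE.
  exists k.+1, (fun j => if j == k then E else setT), (fun=> setT); split.
  - by move=> j; case: eqP => [->//|_]; exact: sigma_rvT.
  - by move=> j; exact: sigma_rvT.
  - by move=> j nj; case: eqP => // jk; case: nj; rewrite jk.
  - by under eq_bigcapr do rewrite setIT; rewrite (one (fun=> E)).
exists k.+1, (fun=> setT), (fun j => if j == k then E else setT); split.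
- by move=> j; exact: sigma_rvT.
- by move=> j; case: eqP => [->//|_]; exact: sigma_rvT.
- by move=> j nj; case: eqP => // jk; case: nj; rewrite jk.
- by under eq_bigcapr do rewrite setTI; rewrite (one (fun=> E)).
Qed.

Lemma noise_independent I I' : I `&` I' = set0 ->
  independent2 P (noise_sigma I) (noise_sigma I').
Proof.
move=> II' A B /noise_sigma_rectangle sA /noise_sigma_rectangle sB.
apply: (independent2_pi _ _ _ _ _ _ _ sA sB).
- exact: rectangle_measurable.
- exact: rectangleI.
- exact: rectangleT.
- exact: rectangle_measurable.
- exact: rectangleI.
- exact: rectangleT.
- by move=> E E'; exact: rectangle_independent.
Qed.

End Independence.

(** * A strong law from a linear variance bound *)

Lemma square_interval (n : nat) : (0 < n)%N ->
  exists k, (k.+1 ^ 2 <= n < k.+2 ^ 2)%N.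
Proof.
elim: n => // -[_ _|n /(_ isT) [k /andP[k1 k2]] _]; first by exists 0%N.
have [h|h] := ltnP n.+2 (k.+2 ^ 2).
  by exists k; rewrite h (leq_trans k1)//.
exists k.+1; rewrite h /=; apply: (leq_ltn_trans k2).
by rewrite ltn_exp2r.
Qed.

(** A nondecreasing sequence is controlled between two consecutive squares by
its values there, and the gaps between squares are negligible. *)
Lemma cvg_interpolate_squares {R : realType} (S s : nat -> R) (hb : R) :
  {homo S : m n / (m <= n)%N >-> m <= n} ->
  (forall n, 0 <= s n.+1 - s n <= hb) ->
  (fun k => (S (k.+1 ^ 2)%N - s (k.+1 ^ 2)%N) / (k.+1 ^ 2)%:R) @ \oo --> 0 ->
  (fun n => (S n - s n) / n%:R) @ \oo --> 0.
Proof.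
move=> Smono sb cvS.
have hb0 : 0 <= hb by have /andP[/le_trans h /h] := sb 0%N.
have smono : {homo s : m n / (m <= n)%N >-> m <= n}.
  apply: homo_leq => [//||n]; first exact: le_trans.
  by have /andP[] := sb n; rewrite subr_ge0.
have sgap m n : s (m + n)%N - s m <= hb * n%:R.
  elim: n => [|n IH]; first by rewrite addn0 subrr mulr0.
  have /andP[_] := sb (m + n)%N; rewrite addnS -natr1 mulrDr mulr1; lra.
apply/cvgrPdist_le => e e0.
have e8 : 0 < e / 8 by rewrite divr_gt0.
have /cvgrPdist_le/(_ _ e8) h1 := cvS.
have h2 : \forall k \near \oo, 6 * hb / e <= k.+1%:R :> R.
  exists (Num.truncn (6 * hb / e)).+1 => // k /= hk.
  apply: ltW; apply: (lt_le_trans (truncnS_gt _)).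
  by rewrite ler_nat ltnW.
have [K _ HK] : \forall k \near \oo, `|0 - (S (k.+1 ^ 2)%N - s (k.+1 ^ 2)%N) / (k.+1 ^ 2)%:R| <= e / 8
  /\ 6 * hb / e <= k.+1%:R by exact: filterI.
exists (K.+1 ^ 2)%N => // n /= Kn.
have n0 : (0 < n)%N by apply: leq_trans Kn; rewrite expn_gt0.
have [k /andP[k1 k2]] := square_interval n0.
have Kk : (K <= k)%N.
  by have := leq_ltn_trans Kn k2; rewrite ltn_exp2r// ltnS.
have [a1 a2] := HK k Kk.
have [b1 _] := HK k.+1 (leqW Kk).
have knR : (k.+1 ^ 2)%:R <= n%:R :> R by rewrite ler_nat.
have kk : (k.+2 ^ 2)%:R <= 4 * (k.+1 ^ 2)%:R :> R.
  rewrite -natrM ler_nat; nia.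
have nR0 : 0 < n%:R :> R by rewrite ltr0n.
have sq0 j : 0 < (j.+1 ^ 2)%:R :> R by rewrite ltr0n expn_gt0.
rewrite !sub0r !normrN !normrM !normfV !(gtr0_norm (sq0 _)) !ler_pdivrMr// in a1 b1.
rewrite sub0r normrN normrM normfV (gtr0_norm nR0) ler_pdivrMr//.
(* the gap between squares is of order k, negligible against n >= k^2 *)
have gap : s (k.+2 ^ 2)%N - s (k.+1 ^ 2)%N <= e / 2 * n%:R.
  have -> : (k.+2 ^ 2 = k.+1 ^ 2 + (2 * k + 3))%N by lia.
  apply: (le_trans (sgap _ _)).
  have : hb * (2 * k + 3)%:R <= hb * (3 * k.+1%:R).
    by apply: ler_wpM2l => //; rewrite -natrM ler_nat; lia.
  move/le_trans; apply.
  have : 6 * hb <= k.+1%:R * e by rewrite -ler_pdivrMr.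
  have : (k.+1%:R * k.+1%:R : R) <= n%:R by rewrite -natrM ler_nat mulnn.
  have : 0 <= k.+1%:R :> R by [].
  move: (k.+1%:R : R) (n%:R : R) => x y x0 xy hx.
  have := ler_wpM2r x0 hx; have := ler_wpM2l (ltW e0) xy.
  by lra.
have S1 := Smono _ _ k1; have S2 := Smono _ _ (ltnW k2).
have s1 := smono _ _ k1; have s2 := smono _ _ (ltnW k2).
move: a1 b1; rewrite !ler_norml => /andP[a1 a1'] /andP[b1 b1'].
have c1 : e / 8 * (k.+2 ^ 2)%:R <= e / 2 * n%:R.
  apply: (@le_trans _ _ (e / 8 * (4 * n%:R))); last by lra.
  apply: ler_wpM2l; first exact: ltW.
  by apply: (le_trans kk); rewrite ler_wpM2l.
have c2 : e / 8 * (k.+1 ^ 2)%:R <= e / 2 * n%:R.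
  apply: (@le_trans _ _ (e / 8 * n%:R)); first by apply: ler_wpM2l => //; exact: ltW.
  by apply: ler_wpM2r; [exact: ltW|lra].
apply/andP; split; lra.
Qed.

Lemma sum_inv_squares {R : realType} n :
  \sum_(k < n) (k.+1%:R ^- 2) <= 2 - 2 / n.+1%:R :> R.
Proof.
elim: n => [|n IH]; first by rewrite big_ord0 divr1 subrr.
rewrite big_ord_recr /=; apply: (le_trans (lerD IH (lexx _))).
have x1 : 1 <= n.+1%:R :> R by rewrite ler1n.
rewrite -(natr1 n.+1); move: (n.+1%:R : R) x1 => x x1.
have x0 : x != 0 by rewrite gt_eqF// (lt_le_trans ltr01).
have x2 : x + 1 != 0 by rewrite gt_eqF// ltr_wpDl// (le_trans ler01).
have -> : x ^- 2 = 2 / x - 2 / (x + 1) - (x - 1) / (x ^+ 2 * (x + 1)).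
  by field; rewrite x2.
have : 0 <= (x - 1) / (x ^+ 2 * (x + 1)).
  rewrite divr_ge0 ?subr_ge0// mulr_ge0 ?sqr_ge0// addr_ge0// (le_trans ler01)//.
lra.
Qed.

Section StrongLaw.
Context {d : measure_display} {Omega : measurableType d} {R : realType}.
Variable P : probability Omega R.
Notation mean f := (\int[P]_w (f w)%:E)%E.

Lemma mean_le (f g : Omega -> R) :
  measurable_fun setT f -> measurable_fun setT g ->
  (forall w, 0 <= f w) -> (forall w, f w <= g w) -> (mean f <= mean g)%E.
Proof.
move=> mf mg f0 fg; apply: ge0_le_integral => //.
- by move=> w _; rewrite lee_fin.
- exact/measurable_EFinP.
- exact/measurable_EFinP.
- by move=> w _; rewrite lee_fin.
Qed.

Lemma meanD (f g : Omega -> R) :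
  measurable_fun setT f -> measurable_fun setT g ->
  (forall w, 0 <= f w) -> (forall w, 0 <= g w) ->
  (mean (fun w => f w + g w)%R = mean f + mean g)%E.
Proof.
move=> mf mg f0 g0; under eq_integral do rewrite EFinD.
apply: ge0_integralD => //.
- by move=> w _; rewrite lee_fin.
- exact/measurable_EFinP.
- by move=> w _; rewrite lee_fin.
- exact/measurable_EFinP.
Qed.

Lemma meanZ (c : R) (f : Omega -> R) : measurable_fun setT f -> 0 <= c ->
  (forall w, 0 <= f w) -> (mean (fun w => c * f w)%R = c%:E * mean f)%E.
Proof.
move=> mf c0 f0; under eq_integral do rewrite EFinM.
apply: ge0_integralZl => //.
- exact/measurable_EFinP.
- by move=> w _; rewrite lee_fin.
Qed.

Lemma mean_cst (c : R) : mean (cst c) = c%:E.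
Proof.
rewrite -[LHS]/(\int[P]_w cst c%:E w)%E integral_cst//.
by rewrite [X in (_ * X)%E](@probability_setT _ _ _ P) mule1.
Qed.

Lemma mean_sum (f : nat -> Omega -> R) n :
  (forall k, measurable_fun setT (f k)) -> (forall k w, 0 <= f k w) ->
  (mean (fun w => \sum_(k < n) f k w)%R = \sum_(k < n) mean (f k))%E.
Proof.
move=> mf f0; elim: n => [|n IH].
  rewrite big_ord0; under eq_integral do rewrite big_ord0.
  by rewrite integral0.
rewrite big_ord_recr /= -IH -meanD//.
- by apply: eq_integral => w _; rewrite big_ord_recr.
- exact: measurable_sum.
- by move=> w; exact: sumr_ge0.
Qed.

Lemma mean_ge0 (f : Omega -> R) : (forall w, 0 <= f w) -> (0 <= mean f)%E.
Proof. by move=> f0; apply: integral_ge0 => w _; rewrite lee_fin. Qed.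

Lemma ae_summable (D : nat -> Omega -> R) (M : R) :
  (forall k, measurable_fun setT (D k)) -> (forall k w, 0 <= D k w) ->
  (forall n, \sum_(k < n) mean (D k) <= M%:E)%E ->
  {ae P, forall w, (fun k => D k w) @ \oo --> 0}.
Proof.
move=> mD D0 hM.
pose F w := (\sum_(0 <= k <oo) (D k w)%:E)%E.
have F0 w : (0 <= F w)%E by apply: nneseries_ge0 => k _ _; rewrite lee_fin.
have mF : measurable_fun setT F.
  apply: ge0_emeasurable_sum => [k w _ _|k _]; first by rewrite lee_fin.
  exact/measurable_EFinP.
have iF : P.-integrable setT F.
  apply/integrableP; split => //.
  under eq_integral do rewrite gee0_abs//.
  rewrite integral_nneseries//.
  - apply: (@le_lt_trans _ _ M%:E); last by rewrite ltry.
    apply: lime_le; first by apply: is_cvg_nneseries => k _ _; exact: mean_ge0.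
    by apply: nearW => n; rewrite big_mkord.
  - by move=> k; exact/measurable_EFinP.
  - by move=> k w _; rewrite lee_fin.
have := integrable_ae measurableT iF; apply: filterS => w /(_ Logic.I) Fw.
apply: (@cvg_series_cvg_0 _ _ (fun k => D k w)).
apply: nondecreasing_is_cvgn.
  by apply: nondecreasing_series => k _ _; exact: D0.
exists (fine (F w)) => _ [n _ <-]; rewrite -lee_fin fineK// /series /= -sumEFin.
by apply: nneseries_lim_ge => k _ _; rewrite lee_fin.
Qed.

(** Chebyshev's inequality along the squares makes the normalized deviations
square summable; interpolation covers the remaining indices. *)
Lemma strong_law_of_variance (H : nat -> Omega -> R) (h : nat -> R) (hb C : R) :
  (forall k, measurable_fun setT (H k)) -> (forall k w, 0 <= H k w) ->
  (forall k, mean (H k) = (h k)%:E) -> (forall k, h k <= hb) -> 0 <= C ->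
  (forall n, mean (fun w => (\sum_(k < n) H k w) ^+ 2)%R <=
     ((\sum_(k < n) h k) ^+ 2 + C * n%:R)%:E)%E ->
  {ae P, forall w,
    (fun n => (\sum_(k < n) H k w - \sum_(k < n) h k) / n%:R) @ \oo --> 0}.
Proof.
move=> mH H0 hE hhb C0 hv.
pose S n w := \sum_(k < n) H k w; pose s n := \sum_(k < n) h k.
have mS n : measurable_fun setT (S n) by exact: measurable_sum.
have S0 n w : 0 <= S n w by apply: sumr_ge0.
have h0 k : 0 <= h k by rewrite -lee_fin -hE mean_ge0.
have s0 n : 0 <= s n by apply: sumr_ge0.
have sE n : mean (S n) = (s n)%:E.
  by rewrite mean_sum// -sumEFin; apply: eq_bigr => k _; exact: hE.
have mD n : measurable_fun setT (fun w => (S n w - s n) ^+ 2).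
  by apply: measurable_funX; exact: measurable_funB.
(* E(S-s)^2 + 2 s E S = E S^2 + s^2, written without subtraction *)
have var n : (mean (fun w => (S n w - s n) ^+ 2)%R <= (C * n%:R)%:E)%E.
  have e1 : (mean (fun w => (S n w - s n) ^+ 2)%R + (2 * s n ^+ 2)%:E =
      mean (fun w => S n w ^+ 2)%R + (s n ^+ 2)%:E)%E.
    have -> : (2 * s n ^+ 2)%:E = mean (fun w => 2 * s n * S n w)%R.
      by rewrite meanZ ?mulr_ge0// sE -EFinM expr2 mulrA.
    rewrite -(mean_cst (s n ^+ 2)) -!meanD//.
    - by apply: eq_integral => w _; congr EFin => /=; ring.
    - exact: measurable_funX.
    - by move=> w; exact: sqr_ge0.
    - by move=> w; exact: sqr_ge0.
    - by apply: measurable_funM.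
    - by move=> w; exact: sqr_ge0.
    - by move=> w; rewrite !mulr_ge0.
  have := hv n; rewrite -(leeD2rE (x := (s n ^+ 2)%:E))// -/(S n) -e1 -EFinD.
  have -> : s n ^+ 2 + C * n%:R + s n ^+ 2 = C * n%:R + 2 * s n ^+ 2 by ring.
  by rewrite EFinD leeD2rE.
pose D k w := ((S (k.+1 ^ 2)%N w - s (k.+1 ^ 2)%N) / (k.+1 ^ 2)%:R) ^+ 2.
have mDD k : measurable_fun setT (D k).
  apply: measurable_funX; apply: measurable_funM => //; exact: measurable_funB.
have DE k w : D k w = ((k.+1 ^ 2)%:R ^- 2) * (S (k.+1 ^ 2)%N w - s (k.+1 ^ 2)%N) ^+ 2.
  by rewrite /D exprMn exprVn mulrC.
have Dle k : (mean (D k) <= (C * k.+1%:R ^- 2)%:E)%E.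
  under eq_integral do rewrite DE.
  rewrite meanZ// ?invr_ge0 ?exprn_ge0//; last by move=> w; exact: sqr_ge0.
  apply: (@le_trans _ _ (((k.+1 ^ 2)%:R ^- 2)%:E * (C * (k.+1 ^ 2)%:R)%:E)%E).
    by apply: lee_wpmul2l => //; rewrite lee_fin invr_ge0 exprn_ge0.
  rewrite -EFinM lee_fin natrX.
  by rewrite le_eqVlt; apply/orP; left; apply/eqP; field.
have sD n : (\sum_(k < n) mean (D k) <= (C * 2)%:E)%E.
  apply: (@le_trans _ _ (\sum_(k < n) (C * k.+1%:R ^- 2)%:E)%E).
    by apply: lee_sum => k _; exact: Dle.
  rewrite sumEFin lee_fin -mulr_sumr ler_wpM2l//.
  by apply: (le_trans (sum_inv_squares n)); rewrite gerBl divr_ge0.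
have := ae_summable mDD (fun k w => sqr_ge0 _) sD; apply: filterS => w Dw.
apply: (@cvg_interpolate_squares _ (fun n => S n w) s hb).
- apply: homo_leq => [//||n]; first exact: le_trans.
  by rewrite /S big_ord_recr /= lerDl.
- by move=> n; rewrite /s big_ord_recr /= addrAC subrr add0r h0 hhb.
apply/cvgrPdist_lt => e e0.
have /cvgrPdist_lt/(_ _ (exprn_gt0 2 e0)) := Dw; apply: filterS => k.
rewrite !sub0r !normrN ger0_norm ?sqr_ge0// => De.
by rewrite -(@ltr_pXn2r _ 2)// ?nnegrE// ?ltW// real_normK ?num_real.
Qed.

End StrongLaw.

(** * Variance of the leg integrals along the reset chain *)

Section ResetChain.
Context {d : measure_display} {Omega : measurableType d} {R : realType}.
Variable P : probability Omega R.
Notation mean f := (\int[P]_w (f w)%:E)%E.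
Context {V : completeNormedModType R} (T : R -> V -> V).
Hypotheses (hVsep : separable_space V)
  (hTcont : time_continuous T) (hTcontr : contractive T)
  (hT0 : forall t : R, 0 <= t -> T t 0 = 0).
Variables (eta : nat -> {RV P >-> borel V}) (beta : nat -> {RV P >-> R}).
Hypotheses (heta_indep : independent_rvs P eta) (hbeta_indep : independent_rvs P beta)
  (heta_beta : independent2 P (sigma_seq eta) (sigma_seq beta))
  (beta0 : forall k w, 0 < beta k w).

(** The space [Omega] with the sigma-algebra of the noise variables indexed by
[I]: measurability on it says of a variable on which part of the noise it
depends, and is inherited by chains from the general lemmas. *)
Definition noise_space (I : set nat) : Type :=
  g_sigma_algebraType (\bigcup_(k in I) (sigma_rv (eta k) `|` sigma_rv (beta k))).
HB.instance Definition _ I := Measurable.on (noise_space I).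
HB.instance Definition _ I := Pointed.on (noise_space I).

Lemma noise_space_eta I k : I k ->
  measurable_fun setT (eta k : noise_space I -> borel V).
Proof.
move=> Ik _ B mB; rewrite setTI; apply: sub_sigma_algebra; exists k => //.
by left; exists B => //; rewrite setTI.
Qed.

Lemma noise_space_beta I k : I k -> measurable_fun setT (beta k : noise_space I -> R).
Proof.
move=> Ik _ B mB; rewrite setTI; apply: sub_sigma_algebra; exists k => //.
by right; exists B => //; rewrite setTI.
Qed.

Lemma noise_space_measurable I {d'} {S : measurableType d'} (f : Omega -> S) :
  measurable_fun setT (f : noise_space I -> S) -> measurable_fun setT f.
Proof.
move=> mf _ B mB; rewrite setTI.
have : noise_sigma eta beta I (f @^-1` B) by rewrite -[_ @^-1` _]setTI; exact: mf.
apply: smallest_sub; first exact: sigma_algebra_measurable.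
by move=> E [k _ [|]]; exact: sigma_rv_measurable.
Qed.

Lemma mean_mul (I I' : set nat) (f g : Omega -> R) : I `&` I' = set0 ->
  measurable_fun setT (f : noise_space I -> R) ->
  measurable_fun setT (g : noise_space I' -> R) ->
  (forall w, 0 <= f w) -> (forall w, 0 <= g w) ->
  (mean (fun w => f w * g w)%R = mean f * mean g)%E.
Proof.
move=> II' mf mg f0 g0.
apply: (integral_mul_independent (noise_independent heta_indep hbeta_indep heta_beta II')) => //.
- exact: noise_space_measurable mf.
- exact: noise_space_measurable mg.
- by move=> B mB; rewrite -[_ @^-1` _]setTI; exact: mf.
- by move=> B mB; rewrite -[_ @^-1` _]setTI; exact: mg.
Qed.

Definition past (m : nat) := [set k | (k < m)%N].
Definition future (m : nat) := [set k | (m <= k)%N].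

Lemma past_future m : past m `&` future m = set0.
Proof.
by apply/seteqP; split => // k [/= h]; rewrite /future /= leqNgt h.
Qed.

Variable r : R.
Notation Tr := (reset_flow T r).

Definition short k (w : Omega) : R := if beta k w < r then 1 else 0.

Lemma short_ge0 k w : 0 <= short k w.
Proof. by rewrite /short; case: ifP. Qed.

Lemma short_sqr k w : short k w ^+ 2 = short k w.
Proof. by rewrite /short; case: ifP; rewrite ?expr1n// expr0n. Qed.

Lemma noise_space_short I k : I k -> measurable_fun setT (short k : noise_space I -> R).
Proof.
by move=> Ik; apply: measurable_fun_ifT => //; apply: measurable_fun_ltr => //;
  exact: noise_space_beta.
Qed.

Lemma reset_contract k w v v' :
  `|Tr (beta k w) v - Tr (beta k w) v'| <= short k w * `|v - v'|.
Proof.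
rewrite /reset_flow /short; case: ifP => _; last by rewrite subrr normr0 mul0r.
by rewrite mul1r; apply: hTcontr; exact: ltW.
Qed.

Lemma reset_chain_contract i k x y w :
  `|chain Tr (fun l => eta (i + l)%N : Omega -> V) (fun l => beta (i + l)%N) x k w -
    chain Tr (fun l => eta (i + l)%N : Omega -> V) (fun l => beta (i + l)%N) y k w|
  <= `|x w - y w| * \prod_(l < k) short (i + l) w.
Proof.
elim: k => [|k IH] /=; first by rewrite big_ord0 mulr1.
rewrite opprD addrACA subrr addr0 big_ord_recr /=; apply: (le_trans (reset_contract _ _ _ _)).
rewrite mulrA mulrC; apply: ler_wpM2r => //; exact: short_ge0.
Qed.

Definition reset_chain (m : nat) : Omega -> V := chain Tr eta beta (cst 0) m.
Notation Z := reset_chain.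

Lemma reset_chain_noise m : measurable_fun setT (Z m : noise_space (past m) -> borel V).
Proof.
apply: measurable_chain => //.
- exact: jointly_measurable_reset.
- by move=> k km; exact: noise_space_eta.
- by move=> k km; exact: noise_space_beta.
Qed.

Lemma noise_space_norm I (f : Omega -> V) :
  measurable_fun setT (f : noise_space I -> borel V) ->
  measurable_fun setT ((fun w => `|f w|) : noise_space I -> R).
Proof. by move=> mf; apply: measurable_continuous_borel mf _; exact: norm_continuous. Qed.

Variables (e2 b b2 p : R).
Hypotheses (heta2 : forall k, (mean (fun w => `|eta k w : V| ^+ 2)%R <= e2%:E)%E)
  (hb : forall k, mean (beta k) = b%:E)
  (hb2 : forall k, (mean (fun w => beta k w ^+ 2)%R <= b2%:E)%E)
  (hp : forall k, mean (short k) = p%:E) (hp1 : p < 1).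

Lemma p_ge0 : 0 <= p.
Proof. by rewrite -lee_fin -(hp 0) mean_ge0// => w; exact: short_ge0. Qed.

Lemma b_ge0 : 0 <= b.
Proof. by rewrite -lee_fin -(hb 0) mean_ge0// => w; exact: ltW. Qed.

Lemma b2_ge0 : 0 <= b2.
Proof. by rewrite -lee_fin (le_trans _ (hb2 0))// mean_ge0// => w; exact: sqr_ge0. Qed.

Lemma e2_ge0 : 0 <= e2.
Proof. by rewrite -lee_fin (le_trans _ (heta2 0))// mean_ge0// => w; exact: sqr_ge0. Qed.

(** The fixed point of the affine recursion for second moments. *)
Definition z2 := (1 + 2 / (1 - p)) * e2 / (1 - (1 + p) / 2).

Lemma z2_ge0 : 0 <= z2.
Proof.
have := e2_ge0; have := hp1 => p1 e0.
rewrite /z2 divr_ge0//; last by lra.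
by rewrite mulr_ge0// addr_ge0// divr_ge0// subr_ge0 ltW.
Qed.

Lemma sqrD_le (x y s : R) : 0 < s ->
  (x + y) ^+ 2 <= (1 + s^-1) * x ^+ 2 + (1 + s) * y ^+ 2.
Proof.
move=> s0; rewrite -subr_ge0.
have -> : (1 + s^-1) * x ^+ 2 + (1 + s) * y ^+ 2 - (x + y) ^+ 2 = (x - s * y) ^+ 2 / s.
  by field; rewrite gt_eqF.
by rewrite divr_ge0 ?sqr_ge0// ltW.
Qed.

(** A reset discards the previous value, so the second moment satisfies an
affine recursion of ratio less than one. *)
Lemma reset_chain_moment m : (mean (fun w => `|Z m w| ^+ 2)%R <= z2%:E)%E.
Proof.
have p1 := hp1; have p0 := p_ge0.
(* this weight makes (1 + s) * p at most (1 + p) / 2, which is below 1 *)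
pose s := (1 - p) / 2.
have s0 : 0 < s by rewrite divr_gt0// subr_gt0.
elim: m => [|m IH].
  rewrite (_ : (fun w => _) = cst 0%:E) ?mean_cst ?lee_fin ?z2_ge0//.
  by apply/funext => w; rewrite /reset_chain /= normr0 expr0n.
have mZ := @reset_chain_noise m.
have mZ2 : measurable_fun setT ((fun w => `|Z m w| ^+ 2) : noise_space (past m) -> R).
  by apply: measurable_funX; exact: noise_space_norm.
have ms : measurable_fun setT (short m : noise_space (future m) -> R).
  by apply: noise_space_short; exact: leqnn.
have me : measurable_fun setT (fun w => `|eta m w : V| ^+ 2).
  apply: measurable_funX; apply: measurable_continuous_borel => //.
  exact: norm_continuous.
have mZ1 : measurable_fun setT (fun w => `|Z m.+1 w| ^+ 2).
  apply: (@noise_space_measurable (past m.+1)).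
  by apply: measurable_funX; apply: noise_space_norm; exact: reset_chain_noise.
have msZ : measurable_fun setT (fun w => short m w * `|Z m w| ^+ 2).
  by apply: measurable_funM; [exact: noise_space_measurable ms|exact: noise_space_measurable mZ2].
apply: (@le_trans _ _ (mean (fun w => (1 + s^-1) * `|eta m w : V| ^+ 2 +
    (1 + s) * (short m w * `|Z m w| ^+ 2))%R)).
  apply: mean_le => //.
  - by apply: measurable_funD; exact: measurable_funM.
  - move=> w; rewrite -(short_sqr m w) -exprMn.
    apply: le_trans (sqrD_le _ _ s0); rewrite ler_pXn2r ?nnegrE//; last first.
      by rewrite addr_ge0// mulr_ge0// short_ge0.
    rewrite /reset_chain /= addrC; apply: (le_trans (ler_normD _ _)).
    rewrite lerD2l; have := reset_contract m w (Z m w) 0.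
    by rewrite /reset_flow; case: ifP => _; rewrite ?(hT0 (ltW (beta0 m w))) !subr0.
have c1 : 0 <= 1 + s^-1 by rewrite addr_ge0// invr_ge0 ltW.
have c2 : 0 <= 1 + s by rewrite addr_ge0// ltW.
have n1 w : 0 <= `|eta m w : V| ^+ 2 by exact: sqr_ge0.
have n2 w : 0 <= short m w * `|Z m w| ^+ 2 by rewrite mulr_ge0 ?sqr_ge0// short_ge0.
rewrite meanD//; [|exact: measurable_funM|exact: measurable_funM|
  by move=> w; rewrite mulr_ge0|by move=> w; rewrite mulr_ge0].
rewrite !meanZ//.
under [X in (_ + _ * X)%E]eq_integral do rewrite mulrC.
rewrite (mean_mul (past_future m) mZ2 ms)//; last exact: short_ge0.
rewrite hp; apply: (@le_trans _ _ ((1 + s^-1)%:E * e2%:E + (1 + s)%:E * (z2%:E * p%:E))%E).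
  apply: leeD; first by apply: lee_wpmul2l => //; rewrite lee_fin addr_ge0// invr_ge0 ltW.
  apply: lee_wpmul2l; first by rewrite lee_fin addr_ge0// ltW.
  by apply: lee_wpmul2r => //; rewrite lee_fin.
rewrite -!EFinM -EFinD lee_fin.
have -> : (1 + s^-1) * e2 = z2 * (1 - (1 + p) / 2).
  by rewrite /z2 /s; field; rewrite !gt_eqF//; lra.
have z0 := z2_ge0.
have : (1 + s) * p <= (1 + p) / 2 by rewrite /s; nra.
by move=> /(ler_wpM2r z0); lra.
Qed.

Lemma mean_prod_short i k : mean (fun w => \prod_(l < k) short (i + l) w) = (p ^+ k)%:E.
Proof.
elim: k => [|k IH].
  by under eq_integral do rewrite big_ord0; rewrite mean_cst.
under eq_integral do rewrite big_ord_recr.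
have mp : measurable_fun setT
    ((fun w => \prod_(l < k) short (i + l) w) : noise_space (past (i + k)) -> R).
  apply: measurable_prod => l _; apply: noise_space_short.
  by rewrite /past /= ltn_add2l.
have ms : measurable_fun setT (short (i + k) : noise_space (future (i + k)) -> R).
  by apply: noise_space_short; exact: leqnn.
rewrite (mean_mul (past_future (i + k)) mp ms).
- by rewrite IH hp -EFinM exprSr.
- by move=> w; apply: prodr_ge0 => l _; exact: short_ge0.
- exact: short_ge0.
Qed.

Lemma sum_geo_le n : \sum_(i < n) p ^+ i <= (1 - p)^-1.
Proof.
have p0 := p_ge0; have p1 := hp1.
rewrite -[leRHS]mul1r ler_pdivlMr ?subr_gt0//.
have e := subrX1 p n.
have : 0 <= p ^+ n by exact: exprn_ge0.
have -> : (\sum_(i < n) p ^+ i) * (1 - p) = 1 - p ^+ n.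
  by rewrite -[RHS]opprB e -mulNr opprB mulrC.
lra.
Qed.

Lemma sum_geo_rev_le n : \sum_(i < n) p ^+ (n.-1 - i) <= (1 - p)^-1.
Proof.
rewrite (reindex_inj rev_ord_inj) /=.
under eq_bigr => i _.
  have -> : (n.-1 - (n - i.+1) = i)%N by have := ltn_ord i; lia.
  over.
exact: sum_geo_le.
Qed.

(** The probability that the first [k] legs are all short is [p ^+ k], which is
summable. *)
Lemma ae_long_leg : {ae P, forall w, exists m, r <= beta m w}.
Proof.
have mD k : measurable_fun setT (fun w => \prod_(l < k) short l w).
  apply: (@noise_space_measurable setT).
  by apply: measurable_prod => l _; exact: noise_space_short.
have D0 k w : 0 <= \prod_(l < k) short l w.
  by apply: prodr_ge0 => l _; exact: short_ge0.
have hD n : (\sum_(k < n) mean (fun w => \prod_(l < k) short l w) <= ((1 - p)^-1)%:E)%E.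
  rewrite (eq_bigr (fun k : 'I_n => (p ^+ k)%:E)); last first.
    by move=> k _; exact: (mean_prod_short 0 k).
  by rewrite sumEFin lee_fin sum_geo_le.
have := ae_summable mD D0 hD; apply: filterS => w Dw.
apply: contrapT => /forallNP h.
have sh l : short l w = 1 by rewrite /short ltNge; case: (r <= beta l w) (h l).
have D1 k : \prod_(l < k) short l w = 1 by rewrite big1.
have : (fun k => \prod_(l < k) short l w) @ \oo --> (1 : R).
  by under eq_fun do rewrite D1; exact: cvg_cst.
by move=> /(cvg_unique (@norm_hausdorff _ _) Dw) /eqP; rewrite eq_sym oner_eq0.
Qed.

Variables (psi : V -> R) (L : R).
Hypotheses (psi0 : forall v, 0 <= psi v) (hL : 0 <= L) (hpsi : lip_bound L psi).

Definition reset_leg m w := leg T psi (beta m w) (Z m w).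
Notation H := reset_leg.

Lemma reset_leg_ge0 m w : 0 <= H m w.
Proof. exact: leg_ge0. Qed.

Lemma measurable_reset_leg m : measurable_fun setT (H m : noise_space (past m.+1) -> R).
Proof.
apply: (measurable_leg hVsep hTcont hTcontr hpsi) => //.
  by apply: noise_space_beta; exact: ltnSn.
apply: measurable_chain => //.
- exact: jointly_measurable_reset.
- by move=> k km; apply: noise_space_eta; exact: ltnW.
- by move=> k km; apply: noise_space_beta; exact: ltnW.
Qed.

Lemma measurable_reset_legT m : measurable_fun setT (H m).
Proof. apply: noise_space_measurable; exact: measurable_reset_leg. Qed.

Lemma leg_growth s v : 0 <= s -> leg T psi s v <= s * (psi 0 + L * `|v|).
Proof.
move=> s0; apply: (leg_le hTcont hTcontr hpsi) => // u u0.
rewrite -lerBlDl; apply: (le_trans (ler_norm _)); apply: (le_trans (hpsi _ _)).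
by rewrite subr0 ler_wpM2l// flow_norm_le.
Qed.

Definition g2 := 2 * psi 0 ^+ 2 + 2 * L ^+ 2 * z2.

Lemma g2_ge0 : 0 <= g2.
Proof.
have := z2_ge0; rewrite /g2; move: z2 => z z0.
by rewrite addr_ge0// !mulr_ge0 ?sqr_ge0.
Qed.

Definition h2 := b2 * g2.

Lemma h2_ge0 : 0 <= h2.
Proof. exact: mulr_ge0 b2_ge0 g2_ge0. Qed.

Lemma measurable_norm_reset_chain m : measurable_fun setT (fun w => `|Z m w|).
Proof.
apply: (@noise_space_measurable (past m)); apply: noise_space_norm.
exact: reset_chain_noise.
Qed.

Lemma noise_space_growth m : measurable_fun setT
  ((fun w => (psi 0 + L * `|Z m w|) ^+ 2) : noise_space (past m) -> R).
Proof.
apply: measurable_funX; apply: measurable_funD => //; apply: measurable_funM => //.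
by apply: noise_space_norm; exact: reset_chain_noise.
Qed.

Lemma mean_growth m : (mean (fun w => (psi 0 + L * `|Z m w|) ^+ 2)%R <= g2%:E)%E.
Proof.
have mZ := measurable_norm_reset_chain m.
apply: (@le_trans _ _ (mean (fun w => 2 * psi 0 ^+ 2 + 2 * L ^+ 2 * `|Z m w| ^+ 2)%R)).
  apply: mean_le => //.
  - by apply: noise_space_measurable; exact: noise_space_growth.
  - by apply: measurable_funD => //; apply: measurable_funM => //; exact: measurable_funX.
  - by move=> w; exact: sqr_ge0.
  - move=> w; rewrite -subr_ge0.
    have -> : 2 * psi 0 ^+ 2 + 2 * L ^+ 2 * `|Z m w| ^+ 2 - (psi 0 + L * `|Z m w|) ^+ 2
      = (psi 0 - L * `|Z m w|) ^+ 2 by ring.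
    exact: sqr_ge0.
have c0 : 0 <= 2 * L ^+ 2 by rewrite mulr_ge0 ?sqr_ge0.
rewrite meanD//.
- rewrite mean_cst meanZ//; last exact: measurable_funX.
  rewrite EFinD; apply: leeD => //.
  by rewrite [leRHS]EFinM; apply: lee_wpmul2l => //; exact: reset_chain_moment.
- by apply: measurable_funM => //; exact: measurable_funX.
- by move=> w; rewrite mulr_ge0 ?sqr_ge0.
- by move=> w; rewrite mulr_ge0 ?sqr_ge0.
Qed.

(** The length of a leg is independent of its starting point. *)
Lemma mean_mul_growth (f : R -> R) (c : R) m : measurable_fun setT f ->
  (forall u, 0 <= f u) -> (mean (fun w => f (beta m w)) <= c%:E)%E ->
  (mean (fun w => f (beta m w) * (psi 0 + L * `|Z m w|) ^+ 2)%R <= (c * g2)%:E)%E.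
Proof.
move=> mf f0 fc.
have mb : measurable_fun setT ((fun w => f (beta m w)) : noise_space (future m) -> R).
  by apply: measurableT_comp => //; apply: noise_space_beta; exact: leqnn.
have mg := @noise_space_growth m.
under eq_integral do rewrite mulrC.
rewrite (mean_mul (past_future m) mg mb)//; last by move=> w; exact: sqr_ge0.
rewrite mulrC EFinM; apply: lee_pmul => //.
- by apply: mean_ge0 => w; exact: sqr_ge0.
- exact: mean_ge0.
- exact: mean_growth.
Qed.

Lemma reset_leg_moment m : (mean (fun w => H m w ^+ 2)%R <= h2%:E)%E.
Proof.
have sqb : measurable_fun setT (fun u : R => u ^+ 2) by exact: measurable_funX.
apply: le_trans (mean_mul_growth sqb (fun u => sqr_ge0 u) (hb2 m)).
have mb : measurable_fun setT (beta m) by [].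
have mZ := measurable_norm_reset_chain m.
apply: mean_le => //.
- by apply: measurable_funX; exact: measurable_reset_legT.
- apply: measurable_funM; first exact: measurable_funX.
  by apply: noise_space_measurable; exact: noise_space_growth.
- by move=> w; exact: sqr_ge0.
- move=> w; rewrite -exprMn; apply: lerXn2r; rewrite ?nnegrE ?reset_leg_ge0//.
    by rewrite mulr_ge0 ?addr_ge0 ?mulr_ge0// ltW.
  by apply: leg_growth; exact: ltW.
Qed.

Lemma mean_le1sqr (f : Omega -> R) (c : R) : measurable_fun setT f ->
  (forall w, 0 <= f w) -> (mean (fun w => f w ^+ 2)%R <= c%:E)%E ->
  (mean f <= (1 + c)%:E)%E.
Proof.
move=> mf f0 fc; apply: (@le_trans _ _ (mean (fun w => 1 + f w ^+ 2)%R)).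
  apply: mean_le => //.
  - by apply: measurable_funD => //; exact: measurable_funX.
  - by move=> w; nra.
rewrite meanD//.
- by rewrite mean_cst EFinD leeD2lE.
- exact: measurable_funX.
- by move=> w; exact: sqr_ge0.
Qed.

Definition reset_mean m : R := fine (mean (H m)).
Notation h := reset_mean.

Lemma reset_leg_mean_le m : (mean (H m) <= (1 + h2)%:E)%E.
Proof.
apply: mean_le1sqr; [exact: measurable_reset_legT|exact: reset_leg_ge0|].
exact: reset_leg_moment.
Qed.

Lemma reset_meanE m : mean (H m) = (h m)%:E.
Proof.
rewrite /reset_mean fineK// ge0_fin_numE; last by apply: mean_ge0 => w; exact: reset_leg_ge0.
exact: le_lt_trans (reset_leg_mean_le m) (ltry _).
Qed.

Lemma reset_mean_ge0 m : 0 <= h m.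
Proof. by rewrite -lee_fin -reset_meanE mean_ge0// => w; exact: reset_leg_ge0. Qed.

Lemma reset_mean_le m : h m <= 1 + h2.
Proof. by rewrite -lee_fin -reset_meanE reset_leg_mean_le. Qed.

(** The dependence of the leg [i + k] on what precedes time [i] survives only
if all legs in between are short. *)
Definition survival i k w := (\prod_(l < k) short (i + l) w) * beta (i + k) w.

Lemma survival_ge0 i k w : 0 <= survival i k w.
Proof.
rewrite /survival mulr_ge0 ?(ltW (beta0 _ _))//.
by apply: prodr_ge0 => l _; exact: short_ge0.
Qed.

Lemma measurable_survival i k :
  measurable_fun setT (survival i k : noise_space (future i) -> R).
Proof.
apply: measurable_funM; last by apply: noise_space_beta; exact: leq_addr.
apply: measurable_prod => l _; apply: noise_space_short; exact: leq_addr.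
Qed.

Lemma mean_survival i k : mean (survival i k) = (p ^+ k * b)%:E.
Proof.
have mp : measurable_fun setT
    ((fun w => \prod_(l < k) short (i + l) w) : noise_space (past (i + k)) -> R).
  apply: measurable_prod => l _; apply: noise_space_short.
  by rewrite /past /= ltn_add2l.
have mb : measurable_fun setT (beta (i + k)%N : noise_space (future (i + k)) -> R).
  by apply: noise_space_beta; exact: leqnn.
rewrite (mean_mul (past_future (i + k)) mp mb).
- by rewrite mean_prod_short hb EFinM.
- by move=> w; apply: prodr_ge0 => l _; exact: short_ge0.
- by move=> w; exact: ltW.
Qed.

(** The leg with index [i + k] of a chain that starts from the origin at time
[i]: it approximates the leg of the reset chain and is independent of the past of [i]. *)
Definition fresh_leg i k w := leg T psi (beta (i + k)%N w)
  (chain Tr (fun l => eta (i + l)%N : Omega -> V) (fun l => beta (i + l)%N) (cst 0) k w).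

Lemma measurable_fresh_leg i k :
  measurable_fun setT (fresh_leg i k : noise_space (future i) -> R).
Proof.
apply: (measurable_leg hVsep hTcont hTcontr hpsi) => //.
  by apply: noise_space_beta; exact: leq_addr.
apply: measurable_chain => //.
- exact: jointly_measurable_reset.
- by move=> l _; apply: noise_space_eta; exact: leq_addr.
- by move=> l _; apply: noise_space_beta; exact: leq_addr.
Qed.

Lemma fresh_leg_dist i k w :
  `|H (i + k) w - fresh_leg i k w| <= L * (`|Z i w| * survival i k w).
Proof.
rewrite /reset_leg /fresh_leg /reset_chain chainD.
apply: (le_trans (leg_lip hTcont hTcontr hpsi _ _ _ _)) => //; first exact: ltW.
rewrite mulrCA; apply: ler_wpM2l => //.
rewrite /survival mulrA [leRHS]mulrC; apply: ler_wpM2l; first exact: ltW.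
by apply: (le_trans (reset_chain_contract _ _ _ _ _)); rewrite subr0.
Qed.

Definition cov_cst := L * b * ((1 + h2) * (1 + z2) + (h2 + z2)).

Lemma cov_cst_ge0 : 0 <= cov_cst.
Proof.
have h0 := h2_ge0; have z0 := z2_ge0.
rewrite !mulr_ge0 ?b_ge0// addr_ge0//; last exact: addr_ge0.
by rewrite mulr_ge0// addr_ge0.
Qed.

(** Correlations decay geometrically: the later leg is a fresh one up to an error
that vanishes unless [k] successive legs are short. Stated for nonnegative
products, so that no integrability has to be discussed. *)
Lemma reset_leg_correlation i k :
  (mean (fun w => H i w * H (i.+1 + k) w)%R <= (h i * h (i.+1 + k) + cov_cst * p ^+ k)%:E)%E.
Proof.
pose j := (i.+1 + k)%N; have h0 := h2_ge0; have z0 := z2_ge0.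
have mHi := @measurable_reset_leg i.
have mHT := measurable_reset_legT.
have H0 := reset_leg_ge0.
have mF := @measurable_fresh_leg i.+1 k.
have mFT : measurable_fun setT (fresh_leg i.+1 k) by exact: noise_space_measurable mF.
have F0 w : 0 <= fresh_leg i.+1 k w by exact: leg_ge0.
have mB := @measurable_survival i.+1 k.
have mBT : measurable_fun setT (survival i.+1 k) by exact: noise_space_measurable mB.
have B0 := survival_ge0 i.+1 k.
have mZ : measurable_fun setT ((fun w => `|Z i.+1 w|) : noise_space (past i.+1) -> R).
  by apply: noise_space_norm; exact: reset_chain_noise.
have mZT := measurable_norm_reset_chain i.+1.
have pk : 0 <= p ^+ k * b by rewrite mulr_ge0 ?b_ge0// exprn_ge0// p_ge0.
have ZB : (mean (fun w => `|Z i.+1 w| * survival i.+1 k w)%R <= ((1 + z2) * (p ^+ k * b))%:E)%E.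
  rewrite (mean_mul (past_future i.+1) mZ mB)// mean_survival [leRHS]EFinM.
  apply: lee_wpmul2r; first by rewrite lee_fin.
  by apply: mean_le1sqr => //; exact: reset_chain_moment.
have HZB : (mean (fun w => (H i w * `|Z i.+1 w|) * survival i.+1 k w)%R <=
    ((h2 + z2) * (p ^+ k * b))%:E)%E.
  have mHZ : measurable_fun setT
    ((fun w => H i w * `|Z i.+1 w|) : noise_space (past i.+1) -> R).
    exact: measurable_funM.
  rewrite (mean_mul (past_future i.+1) mHZ mB)//; last by move=> w; rewrite mulr_ge0.
  rewrite mean_survival [leRHS]EFinM; apply: lee_wpmul2r; first by rewrite lee_fin.
  apply: (@le_trans _ _ (mean (fun w => H i w ^+ 2 + `|Z i.+1 w| ^+ 2)%R)).
    apply: mean_le => //.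
    - exact: measurable_funM.
    - by apply: measurable_funD; exact: measurable_funX.
    - by move=> w; rewrite mulr_ge0.
    - by move=> w; have := sqr_ge0 (H i w - `|Z i.+1 w|);
        have := H0 i w; have := normr_ge0 (Z i.+1 w); nra.
  rewrite meanD; [|exact: measurable_funX|exact: measurable_funX
    |by move=> w; exact: sqr_ge0|by move=> w; exact: sqr_ge0].
  by rewrite EFinD; apply: leeD; [exact: reset_leg_moment|exact: reset_chain_moment].
have mZB : measurable_fun setT (fun w => `|Z i.+1 w| * survival i.+1 k w).
  exact: measurable_funM.
have ZB0 w : 0 <= `|Z i.+1 w| * survival i.+1 k w by rewrite mulr_ge0.
have dist w := fresh_leg_dist i.+1 k w.
(* replace the later leg by a fresh one, decouple, and replace it back *)
have hF : (mean (fresh_leg i.+1 k) <= (h j + L * ((1 + z2) * (p ^+ k * b)))%:E)%E.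
  apply: (@le_trans _ _ (mean (fun w => H j w + L * (`|Z i.+1 w| * survival i.+1 k w))%R)).
    apply: mean_le => //.
    - by apply: measurable_funD => //; exact: measurable_funM.
    - by move=> w; have := dist w; rewrite ler_norml => /andP[]; rewrite -/j; lra.
  rewrite meanD//; [|exact: measurable_funM|by move=> w; rewrite mulr_ge0].
  rewrite meanZ// reset_meanE EFinD; apply: leeD => //.
  by rewrite EFinM; apply: lee_wpmul2l.
apply: (@le_trans _ _ (mean (fun w => H i w * fresh_leg i.+1 k w +
    L * ((H i w * `|Z i.+1 w|) * survival i.+1 k w))%R)).
  apply: mean_le => //.
  - exact: measurable_funM.
  - apply: measurable_funD; first exact: measurable_funM.
    by apply: measurable_funM => //; apply: measurable_funM => //; exact: measurable_funM.
  - by move=> w; rewrite mulr_ge0.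
  - move=> w; have := dist w; rewrite ler_norml => /andP[_].
    rewrite -/j lerBlDl => /(ler_wpM2l (H0 i w)).
    by rewrite mulrDr; congr (_ <= _ + _); ring.
have mHZB : measurable_fun setT (fun w => H i w * `|Z i.+1 w| * survival i.+1 k w).
  by apply: measurable_funM => //; exact: measurable_funM.
have HZB0 w : 0 <= H i w * `|Z i.+1 w| * survival i.+1 k w.
  exact: mulr_ge0 (mulr_ge0 (H0 i w) (normr_ge0 _)) (B0 w).
rewrite meanD//; [|exact: measurable_funM|exact: measurable_funM
   |by move=> w; rewrite mulr_ge0|by move=> w; rewrite mulr_ge0].
rewrite meanZ// (mean_mul (past_future i.+1) mHi mF)// reset_meanE.
apply: (@le_trans _ _ ((h i)%:E * (h j + L * ((1 + z2) * (p ^+ k * b)))%:E +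
   L%:E * ((h2 + z2) * (p ^+ k * b))%:E)%E).
  apply: leeD; first by apply: lee_wpmul2l => //; rewrite lee_fin reset_mean_ge0.
  exact: lee_wpmul2l.
rewrite -!EFinM -EFinD lee_fin -/j.
have hh := reset_mean_le i.
have q0 : 0 <= L * ((1 + z2) * (p ^+ k * b)).
  by apply: mulr_ge0 => //; apply: mulr_ge0 => //; exact: addr_ge0.
have := ler_wpM2r q0 hh; rewrite /cov_cst; lra.
Qed.

Definition var_cst := 2 * cov_cst / (1 - p) + h2.

(** Summing the geometric correlations row by row gives a variance of order [n]. *)
Lemma reset_leg_variance n :
  (mean (fun w => (\sum_(k < n) H k w) ^+ 2)%R <=
     ((\sum_(k < n) h k) ^+ 2 + var_cst * n%:R)%:E)%E.
Proof.
have mHT := measurable_reset_legT; have H0 := reset_leg_ge0.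
elim: n => [|n IH].
  under eq_integral do rewrite big_ord0 expr0n.
  by rewrite mean_cst big_ord0 expr0n/= mulr0 addr0.
pose S w := \sum_(k < n) H k w; pose s := \sum_(k < n) h k.
have mS : measurable_fun setT S by exact: measurable_sum.
have S0 w : 0 <= S w by exact: sumr_ge0.
have SH : (mean (fun w => S w * H n w)%R <= (s * h n + cov_cst / (1 - p))%:E)%E.
  under eq_integral do rewrite /S mulr_suml.
  rewrite (@mean_sum _ _ _ P (fun k w => H k w * H n w)); last 2 first.
  - by move=> k; exact: measurable_funM.
  - by move=> k w; rewrite mulr_ge0.
  apply: (@le_trans _ _ (\sum_(k < n) (h k * h n + cov_cst * p ^+ (n.-1 - k))%:E)%E).
    apply: lee_sum => k _.
    have nE : n = (k.+1 + (n.-1 - k))%N by have := ltn_ord k; lia.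
    by have := reset_leg_correlation k (n.-1 - k); rewrite -nE.
  rewrite sumEFin lee_fin big_split /= -mulr_suml lerD2l -mulr_sumr.
  by apply: ler_wpM2l; [exact: cov_cst_ge0|exact: sum_geo_rev_le].
have expand w : (\sum_(k < n.+1) H k w) ^+ 2 = S w ^+ 2 + (2 * (S w * H n w) + H n w ^+ 2).
  by rewrite big_ord_recr /= -/(S w); ring.
under eq_integral do rewrite expand.
have mSH : measurable_fun setT (fun w => S w * H n w) by exact: measurable_funM.
have SH0 w : 0 <= S w * H n w by rewrite mulr_ge0.
have mSH2 : measurable_fun setT (fun w => 2 * (S w * H n w)) by exact: measurable_funM.
have SH20 w : 0 <= 2 * (S w * H n w) by rewrite mulr_ge0.
have mH2 : measurable_fun setT (fun w => H n w ^+ 2) by exact: measurable_funX.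
have H20 w : 0 <= H n w ^+ 2 by exact: sqr_ge0.
rewrite meanD; [|exact: measurable_funX|exact: measurable_funD
   |by move=> w; exact: sqr_ge0|by move=> w; rewrite addr_ge0].
rewrite meanD// meanZ//.
apply: (@le_trans _ _ ((s ^+ 2 + var_cst * n%:R)%:E +
   (2%:E * (s * h n + cov_cst / (1 - p))%:E + h2%:E))%E).
  apply: leeD => //; apply: leeD; last exact: reset_leg_moment.
  exact: lee_wpmul2l.
rewrite -!EFinM -!EFinD lee_fin big_ord_recr /= -/s -natr1 /var_cst.
have := sqr_ge0 (h n).
move: (cov_cst / (1 - p)) (2 * cov_cst / (1 - p)) (mulrA 2 cov_cst (1 - p)^-1) => x y <-.
lra.
Qed.

Lemma reset_leg_strong_law : {ae P, forall w,
  (fun n => (\sum_(k < n) H k w - \sum_(k < n) h k) / n%:R) @ \oo --> 0}.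
Proof.
apply: (@strong_law_of_variance _ _ _ P H h (1 + h2) var_cst).
- exact: measurable_reset_legT.
- exact: reset_leg_ge0.
- exact: reset_meanE.
- exact: reset_mean_le.
- by rewrite addr_ge0 ?h2_ge0// divr_ge0 ?subr_ge0 ?(ltW hp1)// mulr_ge0// cov_cst_ge0.
- exact: reset_leg_variance.
Qed.

(** Quadratic moments of the observable along the reset chain bound the means of
the excess of the observable over a high level, which is how [tau] arises below. *)
Lemma mean_tail_leg_le (tau : V -> R) (c M : R) m : 0 <= c ->
  (forall v, 0 <= tau v) -> lip_bound M tau -> (forall v, tau v <= c * psi v ^+ 2) ->
  (mean (fun w => leg T tau (beta m w) (Z m w)) <= (c * (b * g2))%:E)%E.
Proof.
move=> c0 tau0 htau tau_le.
have mabs : measurable_fun setT (@Num.norm _ R) by [].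
have hbn : (mean (fun w => `|beta m w|) <= b%:E)%E.
  by rewrite -(hb m); under eq_integral do rewrite (gtr0_norm (beta0 _ _)).
have := mean_mul_growth mabs (fun u => normr_ge0 u) hbn => hm.
have mg : measurable_fun setT (fun w => `|beta m w| * (psi 0 + L * `|Z m w|) ^+ 2).
  apply: measurable_funM; first exact: measurableT_comp.
  by apply: noise_space_measurable; exact: noise_space_growth.
have g0 w : 0 <= `|beta m w| * (psi 0 + L * `|Z m w|) ^+ 2.
  by rewrite mulr_ge0 ?sqr_ge0.
apply: (@le_trans _ _ (mean (fun w => c * (`|beta m w| * (psi 0 + L * `|Z m w|) ^+ 2))%R)).
  apply: mean_le => //.
  - apply: (@noise_space_measurable (past m.+1)).
    apply: (measurable_leg hVsep hTcont hTcontr htau) => //.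
      by apply: noise_space_beta; exact: ltnSn.
    apply: measurable_chain => //.
    + exact: jointly_measurable_reset.
    + by move=> k km; apply: noise_space_eta; exact: ltnW.
    + by move=> k km; apply: noise_space_beta; exact: ltnW.
  - exact: measurable_funM.
  - by move=> w; exact: leg_ge0.
  - move=> w; rewrite gtr0_norm// mulrCA.
    apply: (leg_le hTcont hTcontr htau); first exact: ltW.
    move=> u u0; apply: (le_trans (tau_le _)); apply: ler_wpM2l => //.
    apply: lerXn2r; rewrite ?nnegrE ?psi0// ?addr_ge0 ?mulr_ge0//.
    rewrite -lerBlDl; apply: (le_trans (ler_norm _)); apply: (le_trans (hpsi _ _)).
    by rewrite subr0 ler_wpM2l// flow_norm_le.
rewrite meanZ// [leRHS]EFinM; exact: lee_wpmul2l.
Qed.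

End ResetChain.

(** * Almost sure comparison of the process with the reset chain *)

Section PathBounds.
Context {R : realType} {V : completeNormedModType R} (T : R -> V -> V).
Hypotheses (hVsep : separable_space V)
  (hTcont : time_continuous T) (hTcontr : contractive T)
  (hT0 : forall t : R, 0 <= t -> T t 0 = 0).
Context {S : Type}.
Variables (eta : nat -> S -> V) (beta : nat -> S -> R).
Hypothesis beta0 : forall k w, 0 < beta k w.

Definition time_integral (psi : V -> R) (x : S -> V) (t : R) (w : S) : R :=
  \int[lebesgue_measure]_(u in `[0, t]) psi (process T eta beta x u w).

Lemma time_integralB_ge0 psi L x w s t n : lip_bound L psi -> (forall v, 0 <= psi v) ->
  0 <= s -> s <= t -> t < arrival beta n w ->
  0 <= time_integral psi x t w - time_integral psi x s w.
Proof.
move=> hpsi p0 s0 st tn.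
rewrite /time_integral (path_integralB hVsep hTcont hTcontr hT0 eta beta0 hpsi x s0 st tn).
exact: Rintegral_ge0.
Qed.

Lemma time_integralB_le psi L x w s t n N : lip_bound L psi ->
  (forall v, psi v <= N) -> 0 <= s -> s <= t -> t < arrival beta n w ->
  time_integral psi x t w - time_integral psi x s w <= N * (t - s).
Proof.
move=> hpsi pN s0 st tn.
rewrite /time_integral (path_integralB hVsep hTcont hTcontr hT0 eta beta0 hpsi x s0 st tn).
have -> : N * (t - s) = \int[lebesgue_measure]_(u in `]s, t]) N.
  rewrite /Rintegral integral_cst//= lebesgue_measure_itv /= lte_fin.
  move: st; rewrite le_eqVlt => /predU1P[->|->]; last by rewrite -EFinB -EFinM.
  by rewrite ltxx mule0 subrr mulr0.
apply: le_Rintegral => //.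
- apply: integrableS (integrable_path hVsep hTcont hTcontr hT0 eta beta0 hpsi x tn) => //.
  by apply: subset_itvr; rewrite bnd_simp.
- apply: (integrableS _ _ _ (integrable_itv_cst N s t)) => //.
  by apply: subset_itvr; rewrite bnd_simp.
Qed.

(** After the first leg on which the flow coalesces, the chain and its reset
version stay close for ever, whatever the initial value. *)
Lemma chain_reset_close (eps r : R) (x : S -> V) m w :
  (forall t v v', r <= t -> `|T t v - T t v'| <= eps) -> r <= beta m w ->
  forall k, `|chain T eta beta x (m.+1 + k) w -
    chain (reset_flow T r) eta beta (cst 0) (m.+1 + k) w| <= eps.
Proof.
move=> coal rm.
have long k v v' : r <= beta k w -> `|T (beta k w) v - reset_flow T r (beta k w) v'| <= eps.
  move=> rk; rewrite /reset_flow ltNge rk /= -(hT0 (ltW (beta0 k w))); exact: coal.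
elim=> [|k IH]; first by rewrite addn0 /= opprD addrACA subrr addr0; exact: long.
rewrite addnS /= opprD addrACA subrr addr0.
have [h|h] := leP r (beta (m.+1 + k)%N w); first exact: long.
rewrite /reset_flow h; apply: le_trans IH; apply: hTcontr; exact: ltW.
Qed.

End PathBounds.

Section AlmostSure.
Context {d : measure_display} {Omega : measurableType d} {R : realType}.
Variable P : probability Omega R.
Notation mean f := (\int[P]_w (f w)%:E)%E.
Context {V : completeNormedModType R} (T : R -> V -> V).
Hypotheses (hVsep : separable_space V)
  (hTcont : time_continuous T) (hTcontr : contractive T)
  (hT0 : forall t : R, 0 <= t -> T t 0 = 0).
Variables (eta : nat -> {RV P >-> borel V}) (beta : nat -> {RV P >-> R}).
Hypotheses (heta_indep : independent_rvs P eta) (hbeta_indep : independent_rvs P beta)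
  (heta_beta : independent2 P (sigma_seq eta) (sigma_seq beta))
  (beta0 : forall k w, 0 < beta k w).
Variables (e2 b b2 : R) (p : R -> R).
Hypotheses (heta2 : forall k, (mean (fun w => `|eta k w : V| ^+ 2)%R <= e2%:E)%E)
  (hb : forall k, mean (beta k) = b%:E) (hb0 : 0 < b)
  (hb2 : forall k, (mean (fun w => beta k w ^+ 2)%R <= b2%:E)%E)
  (hp : forall r k, mean (short beta r k) = (p r)%:E) (hp1 : forall r, p r < 1).

Lemma ae_arrival_rate :
  {ae P, forall w, (fun n => arrival beta n w / n%:R) @ \oo --> b}.
Proof.
have lip1 : lip_bound 0 (cst 1 : V -> R) by move=> v w /=; rewrite subrr normr0 mul0r.
have := reset_leg_strong_law hVsep hTcont hTcontr hT0 heta_indep hbeta_indep heta_beta beta0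
   heta2 hb hb2 (hp 0) (hp1 0) (fun _ => ler01) (lexx 0) lip1.
have legE k w : reset_leg T eta beta 0 (cst 1) k w = beta k w.
  by rewrite /reset_leg /leg Rintegral_itv_cst ?mulr1// ltW.
have meanE k : reset_mean T eta beta 0 (cst 1) k = b.
  by rewrite /reset_mean; under eq_integral do rewrite legE; rewrite hb.
apply: filterS => w cv; rewrite -[X in _ --> X](add0r b).
have : (fun n => (\sum_(k < n) reset_leg T eta beta 0 (cst 1) k w -
   \sum_(k < n) reset_mean T eta beta 0 (cst 1) k) / n%:R + b) @ \oo --> 0 + b.
  by apply: cvgD => //; exact: cvg_cst.
apply: cvg_trans; apply: near_eq_cvg; exists 1%N => // n /= n1.
under eq_bigr do rewrite legE.
under [X in _ - X]eq_bigr do rewrite meanE.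
rewrite sumr_const card_ord mulrBl -[b *+ n]mulr_natr mulfK ?subrK//.
by rewrite pnatr_eq0 -lt0n.
Qed.

Lemma arrival_unbounded w t : (fun n => arrival beta n w / n%:R) @ \oo --> b ->
  exists n, t < arrival beta n w.
Proof.
move=> cv.
have bh : 0 < b / 2 by rewrite divr_gt0.
have /cvgrPdist_lt/(_ _ bh) h1 := cv.
have h2 : \forall n \near \oo, t < b / 2 * n%:R.
  exists (Num.truncn (t / (b / 2))).+1 => // n /= hn.
  by rewrite mulrC -ltr_pdivrMr// (lt_le_trans (truncnS_gt _))// ler_nat.
have [n [[h1n h2n] n0]] : exists n, (`|b - arrival beta n w / n%:R| < b / 2 /\
    t < b / 2 * n%:R) /\ (0 < n)%N.
  have : \forall n \near \oo, (`|b - arrival beta n w / n%:R| < b / 2 /\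
    t < b / 2 * n%:R) /\ (0 < n)%N.
    by apply: filterI; [exact: filterI|exists 1%N].
  by move=> /filter_ex.
exists n; apply: (lt_le_trans h2n).
rewrite -ler_pdivlMr ?ltr0n//; move: h1n; rewrite ltr_norml => /andP[_]; lra.
Qed.

Section Observable.
Variables (psi : V -> R) (L eps r : R).
Hypotheses (psi0 : forall v, 0 <= psi v) (hL : 0 <= L) (hpsi : lip_bound L psi)
  (eps0 : 0 < eps) (coal : forall t v v', r <= t -> `|T t v - T t v'| <= eps).
Notation s n := (\sum_(k < n) reset_mean T eta beta r psi k).
Notation I := (time_integral T eta beta psi).

(** Up to a bounded term, coming from the legs before the first coalescence, the
time integral differs from that of the reset chain by [L * eps] times the
elapsed time; the strong law replaces the latter by its mean. *)
Lemma ae_time_integral_arrival : {ae P, forall w, forall (v : V) (e : R), 0 < e ->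
  \forall n \near \oo, `|I (cst v) (arrival beta n w) w - s n| <= (L * eps * b + e) * n%:R}.
Proof.
have := reset_leg_strong_law hVsep hTcont hTcontr hT0 heta_indep hbeta_indep heta_beta beta0
   heta2 hb hb2 (hp r) (hp1 r) psi0 hL hpsi.
have := ae_long_leg heta_indep hbeta_indep heta_beta (hp r) (hp1 r).
have := ae_arrival_rate.
apply: filterS3 => w rate [m rm] law v e e0.
pose c k := leg T psi (beta k w) (chain T eta beta (cst v) k w).
pose z k := reset_leg T eta beta r psi k w.
pose D n := \sum_(k < n) c k - \sum_(k < n) z k.
have close j : `|D (m.+1 + j)%N| <= `|D m.+1| + L * eps * arrival beta (m.+1 + j) w.
  elim: j => [|j IH].
    by rewrite addn0 lerDl mulr_ge0 ?(arrival_ge0 beta0)// mulr_ge0// ltW.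
  have DS n : D n.+1 = D n + (c n - z n) by rewrite /D !big_ord_recr /= opprD addrACA.
  rewrite addnS DS arrivalS.
  apply: (le_trans (ler_normD _ _)); rewrite mulrDr addrA; apply: lerD => //.
  rewrite /c /z /reset_leg.
  apply: (le_trans (leg_lip hTcont hTcontr hpsi _ _ _ _)) => //; first exact: ltW.
  rewrite mulrC; apply: ler_wpM2r; first exact: ltW.
  apply: ler_wpM2l => //.
  exact: (chain_reset_close hTcontr hT0 eta beta0 (cst v) coal rm).
have e3 : 0 < e / 3 by rewrite divr_gt0.
have d0 : 0 < e / (3 * (L * eps + 1)).
  by rewrite divr_gt0// mulr_gt0// ltr_wpDl// mulr_ge0// ltW.
have /cvgrPdist_le/(_ _ e3) h1 := law.
have /cvgrPdist_le/(_ _ d0) h2 := rate.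
have h3 : \forall n \near \oo, `|D m.+1| <= e / 3 * n%:R.
  exists (Num.truncn (`|D m.+1| / (e / 3))).+1 => // n /= hn.
  by rewrite mulrC -ler_pdivrMr// (le_trans (ltW (truncnS_gt _)))// ler_nat.
have h4 : \forall n \near \oo, (m.+1 <= n)%N by exists m.+1.
near=> n.
have mn : (m.+1 <= n)%N by near: n.
have n0 : 0 < n%:R :> R by rewrite ltr0n (leq_trans _ mn).
rewrite /time_integral (path_integral_arrival hVsep hTcont hTcontr hT0 eta beta0 hpsi).
rewrite -[\sum_(_ < _) leg _ _ _ _](subrK (\sum_(k < n) z k)) -addrA.
apply: (le_trans (ler_normD _ _)).
have b1 : `|\sum_(k < n) z k - s n| <= e / 3 * n%:R.
  have : `|0 - (\sum_(k < n) z k - s n) / n%:R| <= e / 3 by near: n.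
  by rewrite sub0r normrN normrM normfV (gtr0_norm n0) ler_pdivrMr.
have b3 : `|D m.+1| <= e / 3 * n%:R by near: n.
have b2' : L * eps * arrival beta n w <= L * eps * b * n%:R + e / 3 * n%:R.
  have : `|b - arrival beta n w / n%:R| <= e / (3 * (L * eps + 1)) by near: n.
  rewrite ler_norml => /andP[+ _]; rewrite lerNl opprB lerBlDr ler_pdivrMr// => h.
  have Le0 : 0 <= L * eps by rewrite mulr_ge0// ltW.
  apply: (le_trans (ler_wpM2l Le0 h)).
  rewrite mulrA mulrDr addrC mulrDl lerD2l; apply: ler_wpM2r; first exact: ltW.
  have Le1 : L * eps + 1 != 0 by rewrite gt_eqF// ltr_wpDl.
  rewrite -subr_ge0 (_ : _ - _ = e / (3 * (L * eps + 1))); first exact: ltW.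
  by field.
have := close (n - m.+1)%N; rewrite subnKC// => b4.
rewrite -/(c _) in b4 *; move: b4; rewrite /D => b4.
apply: (le_trans (lerD b4 b1)).
rewrite mulrDl; lra.
Unshelve. all: by end_near. Qed.

(** For a bounded observable the random times of arrival may be replaced by the
deterministic times [b * n], because [arrival n / n] tends to [b]. *)
Lemma ae_time_integral_bounded (N : R) : (forall v, psi v <= N) ->
  {ae P, forall w, forall (v : V) (e : R), 0 < e ->
  \forall n \near \oo, `|I (cst v) (b * n%:R) w - s n| <= (L * eps * b + e) * n%:R}.
Proof.
move=> pN.
have N0 : 0 <= N by rewrite (le_trans (psi0 0)).
have := ae_time_integral_arrival; have := ae_arrival_rate.
apply: filterS2 => w rate h v e e0.
have e2' : 0 < e / 2 by rewrite divr_gt0.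
have d0 : 0 < e / (2 * (N + 1)) by rewrite divr_gt0// mulr_gt0// ltr_wpDl.
have h1 := h v _ e2'.
have /cvgrPdist_le/(_ _ d0) h2 := rate.
near=> n.
have n0 : 0 < n%:R :> R by rewrite ltr0n; near: n; exists 1%N.
have b1 : `|I (cst v) (arrival beta n w) w - s n| <= (L * eps * b + e / 2) * n%:R by near: n.
have b2' : `|b * n%:R - arrival beta n w| <= e / (2 * (N + 1)) * n%:R.
  have : `|b - arrival beta n w / n%:R| <= e / (2 * (N + 1)) by near: n.
  move=> /(ler_wpM2r (ltW n0)); rewrite -{2}(gtr0_norm n0) -normrM mulrBl mulfVK//.
  by rewrite gt_eqF.
have b3 : `|I (cst v) (b * n%:R) w - I (cst v) (arrival beta n w) w| <= e / 2 * n%:R.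
  apply: (@le_trans _ _ (N * `|b * n%:R - arrival beta n w|)); last first.
    apply: (le_trans (ler_wpM2l N0 b2')); rewrite mulrA; apply: ler_wpM2r; first exact: ltW.
    have N1 : N + 1 != 0 by rewrite gt_eqF// ltr_wpDl.
    rewrite -subr_ge0 (_ : _ - _ = e / (2 * (N + 1))); last by field.
    by rewrite divr_ge0 ?(ltW e0)// mulr_ge0// addr_ge0.
  have [k tk] := arrival_unbounded (Num.max (b * n%:R) (arrival beta n w)) rate.
  move: tk; rewrite gt_max => /andP[k1 k2].
  have bn0 : 0 <= b * n%:R by rewrite mulr_ge0// ltW.
  have a0 := arrival_ge0 beta0 n w.
  have [le|/ltW le] := leP (arrival beta n w) (b * n%:R).
    rewrite !ger0_norm ?subr_ge0//.
      exact: (time_integralB_le hVsep hTcont hTcontr hT0 eta beta0 (cst v) hpsi pN a0 le k1).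
    by rewrite -subr_ge0; exact: (time_integralB_ge0 hVsep hTcont hTcontr hT0 eta beta0 (cst v) hpsi psi0 a0 le k1).
  rewrite distrC (distrC (b * n%:R)) !ger0_norm ?subr_ge0//.
    exact: (time_integralB_le hVsep hTcont hTcontr hT0 eta beta0 (cst v) hpsi pN bn0 le k2).
  by rewrite -subr_ge0; exact: (time_integralB_ge0 hVsep hTcont hTcontr hT0 eta beta0 (cst v) hpsi psi0 bn0 le k2).
rewrite -[I _ _ _](subrK (I (cst v) (arrival beta n w) w)) -addrA.
apply: (le_trans (ler_normD _ _)); apply: (le_trans (lerD b3 b1)).
rewrite !mulrDl; lra.
Unshelve. all: by end_near. Qed.

End Observable.
End AlmostSure.

(** * Identification of the limit with the invariant mean *)

Section Identification.
Context {d : measure_display} {Omega : measurableType d} {R : realType}.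
Variable P : probability Omega R.
Context {V : completeNormedModType R} (T : R -> V -> V).
Hypotheses (hVsep : separable_space V)
  (hTcont : time_continuous T) (hTcontr : contractive T).
Variables (eta : nat -> {RV P >-> borel V}) (beta : nat -> {RV P >-> R}).
Hypothesis beta0 : forall k w, 0 < beta k w.
Variable mu : probability (borel V) R.
Hypothesis hmu : invariant_measure P T eta beta mu.
Notation Q := (mu \x P)%E.
Notation leb := (@lebesgue_measure R).

Lemma measurable_process_comp {d'} {S : measurableType d'}
    (x : S -> borel V) (t : S -> R) (phi : S -> Omega) :
  measurable_fun setT x -> measurable_fun setT t -> measurable_fun setT phi ->
  measurable_fun setT (fun y => process T eta beta (cst (x y)) (t y) (phi y) : borel V).
Proof.
move=> mx mt mphi.
have -> : (fun y => process T eta beta (cst (x y)) (t y) (phi y) : borel V) =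
    fun y => process T (fun k y => eta k (phi y)) (fun k y => beta k (phi y)) x (t y) y.
  apply/funext => y; apply/esym.
  exact: (process_comp T (fun k => eta k : Omega -> V) (fun k => beta k : Omega -> R) phi x t y).
apply: (measurable_process hVsep hTcont hTcontr) => // k.
- exact: (measurableT_comp (measurable_funPT (eta k))).
- exact: (measurableT_comp (measurable_funPT (beta k))).
Qed.

(** Invariance says that the image of the product of [mu] and the noise under
the process at time [t] agrees with [mu] on Borel sets. *)
Lemma invariant_mean (t : R) (f : borel V -> \bar R) : 0 <= t ->
  measurable_fun setT f -> (forall v, (0 <= f v)%E) ->
  (\int[mu]_v f v = \int[Q]_z f (process T eta beta (cst z.1) t z.2))%E.
Proof.
move=> t0 mf f0.
pose phi (z : borel V * Omega) : borel V := process T eta beta (cst z.1) t z.2.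
have mphi : measurable_fun setT phi.
  exact: (measurable_process_comp (x := fst) (t := cst t) (phi := snd)).
pose X : {RV Q >-> borel V} := mfun_Sub (mem_set mphi).
have law (B : set (borel V)) : measurable B -> mu B = distribution Q X B.
  move=> mB; rewrite -(hmu t0 mB) /distribution /pushforward /=.
  rewrite /product_measure1 /=; apply: eq_integral => v _.
  rewrite /transition; congr (P _); apply/seteqP; split => w /=.
    by rewrite /xsection /= inE.
  by rewrite /xsection /= inE.
rewrite (eq_measure_integral (distribution Q X)); last by move=> A mA _; exact: law.
by rewrite (ge0_integral_distribution X).
Qed.

Variables (psi : V -> R) (L N : R).
Hypotheses (psi0 : forall v, 0 <= psi v) (psiN : forall v, psi v <= N)
  (hpsi : lip_bound L psi).
Notation I v t w := (time_integral T eta beta psi (cst v) t w).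
Notation m := (\int[mu]_v psi v).

Let mpsi : measurable_fun setT (psi : borel V -> R).
Proof.
apply: (measurable_continuous_borel (f := id)) => //; exact: lip_bound_continuous hpsi.
Qed.

Lemma invariant_mean_fin : (\int[mu]_v (psi v)%:E)%E = m%:E.
Proof.
rewrite /Rintegral fineK// ge0_fin_numE; last by apply: mean_ge0.
apply: (@le_lt_trans _ _ (\int[mu]_v (cst N v)%:E)%E); last by rewrite mean_cst ltry.
exact: mean_le.
Qed.

Let h (t : R) (y : (borel V * Omega) * R) : \bar R := ((if 0 <= y.2 <= t then
   psi (process T eta beta (cst y.1.1) y.2 y.1.2) else 0)%:E)%E.

Let h_ge0 t y : (0 <= h t y)%E.
Proof. by rewrite /h lee_fin; case: ifP. Qed.

Let measurable_h t : measurable_fun setT (h t).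
Proof.
apply/measurable_EFinP; apply: measurable_fun_ifT => //.
  by apply: measurable_and; apply: measurable_fun_ler.
apply: (@measurable_continuous_borel _ _ _ V); last exact: lip_bound_continuous hpsi.
apply: (@measurable_process_comp _ _ (fun y => y.1.1) snd (fun y => y.1.2)) => //.
- exact: (measurableT_comp measurable_fst measurable_fst).
- exact: (measurableT_comp measurable_snd measurable_fst).
Qed.

Let time_integralE t z : 0 <= t -> (I z.1 t z.2)%:E = fubini_F leb (h t) z.
Proof.
move=> t0.
have e : (\int[leb]_(u in `[0%R, t]) (psi (process T eta beta (cst z.1) u z.2))%:E =
    fubini_F leb (h t) z)%E.
  rewrite integral_mkcond /fubini_F; apply: eq_integral => u _.
  by rewrite /h patchE mem_setE in_itv /=; case: ifP.
rewrite -e /time_integral /Rintegral fineK// ge0_fin_numE; last first.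
  by apply: integral_ge0 => u _; rewrite lee_fin.
apply: (@le_lt_trans _ _ (\int[leb]_(u in `[0%R, t]) (cst N%:E u))%E); last first.
  rewrite integral_cst//= lebesgue_measure_itv /=.
  by case: ifP => _; rewrite ?mule0 ?ltry// -EFinB -EFinM ltry.
apply: ge0_le_integral => //.
- by move=> u _; rewrite lee_fin.
- apply: measurable_funTS; apply/measurable_EFinP.
  apply: (@measurable_continuous_borel _ _ _ V); last exact: lip_bound_continuous hpsi.
  exact: (@measurable_process_comp _ _ (cst z.1) id (cst z.2)).
- by move=> u _; rewrite lee_fin.
Qed.

Lemma measurable_time_integral t : 0 <= t ->
  measurable_fun setT (fun z : borel V * Omega => I z.1 t z.2).
Proof.
move=> t0; apply/measurable_EFinP.
have -> : EFin \o (fun z : borel V * Omega => I z.1 t z.2) = fubini_F leb (h t).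
  by apply/funext => z; rewrite -time_integralE.
apply: measurable_fun_fubini_tonelli_F; [exact: measurable_h|exact: h_ge0].
Qed.

Lemma mean_time_integral t : 0 <= t -> (\int[Q]_z (I z.1 t z.2)%:E = (t * m)%:E)%E.
Proof.
move=> t0.
transitivity (\int[Q]_z \int[leb]_u h t (z, u))%E.
  by apply: eq_integral => z _; rewrite time_integralE.
pose Q' : probability (borel V * Omega)%type R := Q.
rewrite (@fubini_tonelli _ _ _ _ R Q' leb (h t) (@measurable_h t) (@h_ge0 t)).
transitivity (\int[leb]_(u in `[0%R, t]) (cst m%:E u))%E.
  rewrite [RHS]integral_mkcond; apply: eq_integral => u _.
  rewrite patchE mem_setE in_itv /= /h /=; case: ifP => [/andP[u0 _]|_].
    rewrite -invariant_mean_fin -(@invariant_mean u (EFin \o psi))//.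
    by apply/measurable_EFinP.
  by rewrite integral0.
rewrite integral_cst//= lebesgue_measure_itv /= lte_fin.
move: t0; rewrite le_eqVlt => /predU1P[<-|->]; first by rewrite ltxx mule0 mul0r.
by rewrite oppr0 adde0 -EFinM mulrC.
Qed.

Lemma time_integral_ge0 v t w : 0 <= I v t w.
Proof. exact: Rintegral_ge0. Qed.

Lemma time_integral_le v t w : 0 <= t -> I v t w <= t * N.
Proof.
move=> t0; rewrite -lee_fin (time_integralE (v, w))// /fubini_F.
apply: (@le_trans _ _ (\int[leb]_(u in `[0%R, t]) (cst N%:E u))%E).
  rewrite [leRHS]integral_mkcond; apply: ge0_le_integral => //.
  - exact: (measurableT_comp (measurable_h t) (measurable_pair1 _)).
  - apply/(measurable_restrictT _ _).1 => //; exact: measurable_cst.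
  - move=> u _; rewrite /h /= patchE mem_setE in_itv /=; case: ifP => _ //.
    by rewrite lee_fin.
rewrite integral_cst//= lebesgue_measure_itv /= lte_fin.
move: t0; rewrite le_eqVlt => /predU1P[<-|->]; first by rewrite ltxx mule0 mul0r.
by rewrite oppr0 adde0 -EFinM mulrC.
Qed.

Lemma ae_product (E : Omega -> Prop) :
  {ae P, forall w, E w} -> {ae Q, forall z : borel V * Omega, E z.2}.
Proof.
move=> [A [mA PA EA]]; exists (setT `*` A); split.
- exact: measurableX.
- by rewrite (product_measure1E mu P)// [X in (_ * X)%E]PA mule0.
- by move=> z /= Ez; split => //; exact: EA.
Qed.

(** Since [mu] is invariant, the mean of the time average is exactly [m]; an
almost sure deterministic equivalent of the time average therefore
approximates [m], by dominated convergence. *)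
Lemma identify_limit (b c K : R) (s : nat -> R) : 0 < b -> 0 <= c ->
  (forall n, 0 <= s n <= K * n%:R) ->
  {ae P, forall w, forall (v : V) (e : R), 0 < e ->
    \forall n \near \oo, `|I v (b * n%:R) w - s n| <= (c + e) * n%:R} ->
  forall e, 0 < e -> \forall n \near \oo, `|b * n%:R * m - s n| <= (c + e) * n%:R.
Proof.
move=> b0 c0 sK hae e e0.
have bn0 n : 0 <= b * n%:R by rewrite mulr_ge0// ltW.
have K0 : 0 <= K by have /andP[] := sK 1%N; rewrite mulr1; exact: le_trans.
have N0 : 0 <= N by rewrite (le_trans (psi0 0)).
(* the excess of the deviation over its asymptotic bound: it vanishes in the limit *)
pose g n (z : borel V * Omega) := Num.max (`|I z.1 (b * n%:R) z.2 - s n| / n%:R - c) 0.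
have mg n : measurable_fun setT (g n).
  apply: measurable_maxr => //; apply: measurable_funB => //; apply: measurable_funM => //.
  apply: measurableT_comp => //; apply: measurable_funB => //.
  exact: measurable_time_integral.
have g0 n z : 0 <= g n z by rewrite le_max lexx orbT.
have gE n z : (0 < n)%N -> `|I z.1 (b * n%:R) z.2 - s n| <= (c + g n z) * n%:R.
  move=> n0; rewrite -ler_pdivrMr ?ltr0n// -lerBlDl /g.
  by rewrite le_max lexx.
have gle n z : g n z <= b * N + K.
  rewrite /g ge_max; apply/andP; split; last by rewrite addr_ge0// mulr_ge0// ltW.
  rewrite lerBlDr; apply: (@le_trans _ _ (b * N + K)); last by rewrite lerDl.
  case: n => [|n]; first by rewrite invr0 mulr0 addr_ge0// mulr_ge0// ltW.
  rewrite ler_pdivrMr//; apply: (le_trans (ler_normB _ _)).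
  have /andP[s0 sk] := sK n.+1.
  rewrite !ger0_norm ?time_integral_ge0// mulrDl lerD//.
  by apply: (le_trans (time_integral_le _ _ (bn0 _))); rewrite mulrAC.
have cvg_g : {ae Q, forall z, setT z -> (fun n => (g n z)%:E) @ \oo --> (cst 0%E z : \bar R)}.
  have := ae_product hae; apply: filterS => z hz _ /=.
  apply: cvg_EFin; first exact: nearW.
  apply/cvgrPdist_le => e' e'0; near=> n.
  have n0 : (0 < n)%N by near: n; exists 1%N.
  rewrite sub0r normrN ger0_norm ?g0// /g ge_max (ltW e'0) andbT.
  rewrite lerBlDl ler_pdivrMr ?ltr0n//.
  by near: n; exact: hz.
pose Q' : probability (borel V * Omega)%type R := Q.
have mgE n : measurable_fun setT (fun z => (g n z)%:E) by exact/measurable_EFinP.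
have dom : {ae Q', forall z, forall n, setT z -> (`|(g n z)%:E| <= (cst (b * N + K)%:E) z)%E}.
  by apply: aeW => z n _; rewrite /= ger0_norm ?g0// lee_fin gle.
have [_ _] := @dominated_convergence _ _ R Q' setT measurableT (fun n z => (g n z)%:E)
  (cst 0%E) (cst (b * N + K)%:E) mgE (@measurable_cst _ _ _ _ setT 0%E) cvg_g
  (finite_measure_integrable_cst Q' (b * N + K) measurableT) dom.
rewrite [X in _ --> X](_ : _ = 0%E); last by rewrite integral0.
move=> /fine_cvgP[fing /cvgrPdist_le/(_ _ e0) leg].
near=> n.
have n0 : (0 < n)%N by near: n; exists 1%N.
have nR : 0 < n%:R :> R by rewrite ltr0n.
have meang : (\int[Q']_z (g n z)%:E <= e%:E)%E.
  have gf : (\int[Q']_z (g n z)%:E)%E \is a fin_num by near: n.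
  have ge : `|0 - fine (\int[Q']_z (g n z)%:E)%E| <= e by near: n.
  by rewrite -(fineK gf) lee_fin (le_trans _ ge)// sub0r normrN ler_norm.
have mI : measurable_fun setT (fun z : borel V * Omega => I z.1 (b * n%:R) z.2).
  exact: measurable_time_integral.
have mng : measurable_fun setT (fun z => n%:R * g n z) by exact: measurable_funM.
have ng0 z : 0 <= n%:R * g n z by rewrite mulr_ge0.
have /andP[sn0 _] := sK n.
have cn0 : 0 <= c * n%:R by rewrite mulr_ge0.
have meanng : (\int[Q']_z (n%:R * g n z)%:E <= (e * n%:R)%:E)%E.
  rewrite meanZ// mulrC EFinM; exact: lee_wpmul2l.
have meanI := mean_time_integral (bn0 n).
rewrite ler_norml lerBlDr lerNl opprB lerBlDr; apply/andP; split.
- rewrite addrC -lee_fin -(mean_cst Q' (s n)).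
  apply: (@le_trans _ _ (\int[Q']_z (I z.1 (b * n%:R) z.2 + (c * n%:R + n%:R * g n z))%:E)%E).
    apply: mean_le => //.
    + by apply: measurable_funD => //; exact: measurable_funD.
    + move=> z /=; have := gE n z n0; rewrite distrC => /(le_trans (ler_norm _)).
      rewrite mulrDl (mulrC (g n z)); lra.
  rewrite meanD//; [|exact: measurable_funD|by move=> z; exact: time_integral_ge0
    |by move=> z; rewrite addr_ge0].
  rewrite meanI EFinD leeD2lE// meanD// mean_cst mulrDl EFinD.
  exact: leeD.
- rewrite -lee_fin -meanI.
  apply: (@le_trans _ _ (\int[Q']_z ((s n + c * n%:R) + n%:R * g n z)%:E)%E).
    apply: mean_le => //.
    + exact: measurable_funD.
    + by move=> z; exact: time_integral_ge0.
    + move=> z; have := gE n z n0 => /(le_trans (ler_norm _)).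
      rewrite mulrDl (mulrC (g n z)); lra.
  rewrite meanD//; last by move=> z; rewrite addr_ge0.
  have -> : (c + e) * n%:R + s n = s n + c * n%:R + e * n%:R by ring.
  by rewrite mean_cst [leRHS]EFinD; exact: leeD.
Unshelve. all: by end_near. Qed.

End Identification.

(** * Truncation and passage to continuous time *)

Section Truncation.
Context {R : realType} {V : completeNormedModType R}.
Variables (L : R) (psi : V -> R).
Hypothesis hpsi : lip_bound L psi.

Lemma lip_bound_comp (f : R -> R) : (forall a c, `|f a - f c| <= `|a - c|) ->
  lip_bound L (fun v => f (psi v)).
Proof. by move=> hf v w; exact: le_trans (hf _ _) (hpsi v w). Qed.

Let norm_bounds (a c : R) : a - c <= `|a - c| /\ c - a <= `|a - c|.
Proof. by split; [exact: ler_norm|rewrite distrC; exact: ler_norm]. Qed.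

Lemma lip_bound_min c : lip_bound L (fun v => Num.min (psi v) c).
Proof.
apply: (@lip_bound_comp (fun a => Num.min a c)) => x y.
have [h1 h2] := norm_bounds x y; have h3 := normr_ge0 (x - y).
by rewrite ler_norml; case: (leP x c) => ?; case: (leP y c) => ?; apply/andP; split; lra.
Qed.

Lemma lip_bound_excess c : lip_bound L (fun v => psi v - Num.min (psi v) c).
Proof.
apply: (@lip_bound_comp (fun a => a - Num.min a c)) => x y.
have [h1 h2] := norm_bounds x y; have h3 := normr_ge0 (x - y).
by rewrite ler_norml; case: (leP x c) => ?; case: (leP y c) => ?; apply/andP; split; lra.
Qed.

Lemma lip_bound_pos : lip_bound L (fun v => Num.max (psi v) 0).
Proof.
apply: (@lip_bound_comp (fun a => Num.max a 0)) => x y.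
have [h1 h2] := norm_bounds x y; have h3 := normr_ge0 (x - y).
by rewrite ler_norml; case: (leP x 0) => ?; case: (leP y 0) => ?; apply/andP; split; lra.
Qed.

Lemma lip_bound_neg : lip_bound L (fun v => Num.max (- psi v) 0).
Proof.
apply: (@lip_bound_comp (fun a => Num.max (- a) 0)) => x y.
have [h1 h2] := norm_bounds x y; have h3 := normr_ge0 (x - y).
by rewrite ler_norml; case: (leP (- x) 0) => ?; case: (leP (- y) 0) => ?;
  apply/andP; split; lra.
Qed.

End Truncation.

(** Consecutive arrival times differ by a vanishing fraction of their size, so
monotonicity determines the growth in between. *)
Lemma cvg_average_of_arrivals {R : realType} (f : R -> R) (a : nat -> R) (b m : R) :
  0 < b -> 0 <= m -> a 0%N = 0 -> (forall n, 0 <= a n) ->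
  (forall s t, 0 <= s -> s <= t -> f s <= f t) ->
  (forall t, 0 <= t -> exists n, a n <= t < a n.+1) ->
  {homo a : m n / (m <= n)%N >-> m <= n} ->
  (forall e, 0 < e -> \forall n \near \oo, `|a n - b * n%:R| <= e * n%:R) ->
  (forall e, 0 < e -> \forall n \near \oo, `|f (a n) - b * n%:R * m| <= e * n%:R) ->
  (fun t => t^-1 * f t) @ +oo --> m.
Proof.
move=> b0 m0 a0 age0 fmono aint amono ha hf.
apply/cvgrPdist_le => e e0.
pose dl := Num.min (b / 2) (e * b / (16 * (1 + m))).
have m1 : 0 < 1 + m by rewrite ltr_pwDl.
have d0 : 0 < dl by rewrite lt_min !divr_gt0 ?mulr_gt0.
have d1 : dl <= b / 2 by rewrite ge_min lexx.
have d2 : dl * (1 + m) <= e * b / 16.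
  rewrite -ler_pdivlMr//; apply: (@le_trans _ _ (e * b / (16 * (1 + m)))).
    by rewrite ge_min lexx orbT.
  by rewrite invfM mulrA.
have h3 : \forall n \near \oo, 16 * (b * m + 1) / (e * b) <= n%:R.
  exists (Num.truncn (16 * (b * m + 1) / (e * b))).+1 => // n /= hn.
  by apply: (le_trans (ltW (truncnS_gt _))); rewrite ler_nat.
have [N0 _ HN] : \forall n \near \oo, [/\ `|a n - b * n%:R| <= dl * n%:R,
    `|f (a n) - b * n%:R * m| <= dl * n%:R, 16 * (b * m + 1) / (e * b) <= n%:R & (0 < n)%N].
  near=> n; split; near: n; [exact: ha|exact: hf|exact: h3|by exists 1%N].
near=> t.
have tN : a N0 <= t by near: t; apply: nbhs_pinfty_ge; exact: num_real.
have t0 : 0 <= t by rewrite (le_trans (age0 N0)).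
have [n /andP[an tn]] := aint t t0.
have Nn : (N0 <= n)%N.
  rewrite leqNgt; apply/negP => nN.
  by have := lt_le_trans tn (le_trans (amono _ _ nN) tN); rewrite ltxx.
have [] := HN n Nn; have [] := HN n.+1 (leqW Nn).
rewrite -!natr1 => A1 F1 _ _ A F B n0.
have nR : 1 <= n%:R :> R by rewrite ler1n.
have f1 := fmono _ _ (age0 n) an.
have f2 := fmono _ _ t0 (ltW tn).
have eb : 0 < e * b by rewrite mulr_gt0.
move: B; rewrite ler_pdivrMr// => B.
rewrite !ler_norml in A1 F1 A F.
move: A1 F1 A F => /andP[A1 A1'] /andP[F1 F1'] /andP[A A'] /andP[F F'].
have tpos : 0 < t.
  apply: lt_le_trans an; apply: (@lt_le_trans _ _ (b * n%:R - dl * n%:R)).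
    by rewrite -mulrBl; apply: mulr_gt0; [lra|exact: lt_le_trans nR].
  by lra.
have tb : b / 2 * n%:R <= t.
  apply: le_trans an.
  have := ler_wpM2r (le_trans ler01 nR) d1; lra.
have key : `|t * m - f t| <= e * t.
  have et := ler_wpM2l (ltW e0) tb.
  have c1 : dl * (n%:R + 1) <= 2 * (dl * n%:R).
    rewrite mulrCA ler_pM2l//; lra.
  have c2 : m * (dl * (n%:R + 1)) <= m * (2 * (dl * n%:R)) by exact: ler_wpM2l.
  have c3 := ler_wpM2r (le_trans ler01 nR) d2.
  have c4 : 0 <= dl * n%:R by rewrite mulr_ge0 ?(ltW d0)// (le_trans ler01).
  have c5 : 0 <= m * (dl * n%:R) by rewrite mulr_ge0.
  have g1 := ler_wpM2l m0 (ltW tn).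
  have g2 := ler_wpM2l m0 an.
  have g3 : m * a n.+1 <= m * (b * (n%:R + 1) + dl * (n%:R + 1)) by apply: ler_wpM2l => //; lra.
  have g4 : m * (b * n%:R - dl * n%:R) <= m * a n by apply: ler_wpM2l => //; lra.
  rewrite ler_norml; apply/andP; split; nra.
have res : `|(t * m - f t) / t| <= e.
  by rewrite normrM normfV (gtr0_norm tpos) ler_pdivrMr.
rewrite (_ : m - t^-1 * f t = (t * m - f t) / t)//.
by rewrite mulrBl (mulrC t) mulfK ?gt_eqF// (mulrC (f t)).
Unshelve. all: by end_near. Qed.

(** * The strong law for nonnegative Lipschitz observables *)

Section Ergodic.
Context {d : measure_display} {Omega : measurableType d} {R : realType}.
Variable P : probability Omega R.
Notation mean f := (\int[P]_w (f w)%:E)%E.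
Context {V : completeNormedModType R} (T : R -> V -> V).
Hypotheses (hVsep : separable_space V)
  (hTcont : time_continuous T) (hTcontr : contractive T)
  (hT0 : forall t : R, 0 <= t -> T t 0 = 0) (hcoal : coalescing T).
Variables (eta : nat -> {RV P >-> borel V}) (beta : nat -> {RV P >-> R}).
Hypotheses (heta_indep : independent_rvs P eta) (hbeta_indep : independent_rvs P beta)
  (heta_beta : independent2 P (sigma_seq eta) (sigma_seq beta))
  (beta0 : forall k w, 0 < beta k w).
Variables (e2 b b2 : R) (p : R -> R).
Hypotheses (heta2 : forall k, (mean (fun w => `|eta k w : V| ^+ 2)%R <= e2%:E)%E)
  (hb : forall k, mean (beta k) = b%:E) (hb0 : 0 < b)
  (hb2 : forall k, (mean (fun w => beta k w ^+ 2)%R <= b2%:E)%E)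
  (hp : forall r k, mean (short beta r k) = (p r)%:E) (hp1 : forall r, p r < 1).
Variable mu : probability (borel V) R.
Hypothesis hmu : invariant_measure P T eta beta mu.

Notation I psi v t w := (time_integral T eta beta psi (cst v) t w).
Notation s r psi n := (\sum_(k < n) reset_mean T eta beta r psi k).

Lemma reset_mean_sum_bounds r psi L n : (forall v, 0 <= psi v) -> 0 <= L ->
  lip_bound L psi ->
  0 <= s r psi n <= (1 + h2 e2 b2 (p r) psi L) * n%:R.
Proof.
move=> p0 L0 hpsi; apply/andP; split.
  apply: sumr_ge0 => k _.
  exact: (reset_mean_ge0 hVsep hTcont hTcontr hT0 heta_indep hbeta_indep heta_beta beta0
    heta2 hb2 (hp r) (hp1 r) p0 L0 hpsi).
rewrite -[X in X%:R]card_ord -sum1_card natr_sum mulr_sumr; apply: ler_sum => k _.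
rewrite mulr1.
exact: (reset_mean_le hVsep hTcont hTcontr hT0 heta_indep hbeta_indep heta_beta beta0
    heta2 hb2 (hp r) (hp1 r) p0 L0 hpsi).
Qed.

Lemma tail_mean_sum_le r psi L tau M c n : (forall v, 0 <= psi v) -> 0 <= L ->
  lip_bound L psi -> 0 <= c -> (forall v, 0 <= tau v) -> 0 <= M -> lip_bound M tau ->
  (forall v, tau v <= c * psi v ^+ 2) ->
  s r tau n <= c * (b * g2 e2 (p r) psi L) * n%:R.
Proof.
move=> p0 L0 hpsi c0 t0 M0 htau hle.
rewrite -[X in X%:R]card_ord -sum1_card natr_sum mulr_sumr; apply: ler_sum => k _.
rewrite mulr1 -lee_fin.
rewrite -(reset_meanE hVsep hTcont hTcontr hT0 heta_indep hbeta_indep heta_beta beta0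
    heta2 hb2 (hp r) (hp1 r) t0 M0 htau).
exact: (mean_tail_leg_le hVsep hTcont hTcontr hT0 heta_indep hbeta_indep heta_beta beta0
    heta2 hb (hp r) (hp1 r) p0 L0 hpsi).
Qed.

(** The form in which asymptotics along the arrival times are used; [b] is the
mean duration of a leg. *)
Definition linear_equivalent (f : nat -> R) (c : R) :=
  forall e, 0 < e -> \forall n \near \oo, `|f n - b * n%:R * c| <= e * n%:R.

Lemma small_scale (L : R) e : 0 <= L -> 0 < e ->
  exists j, L * j.+1%:R^-1 * b <= e.
Proof.
move=> L0 e0.
have [j _ /(_ j (leqnn j)) /= h] : \forall j \near \oo, (L * b) / e <= j.+1%:R.
  exists (Num.truncn (L * b / e)) => // j /= hj.
  by apply: (le_trans (ltW (truncnS_gt _))); rewrite ler_nat.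
exists j; rewrite mulrAC ler_pdivrMr//; move: h; rewrite ler_pdivrMr//.
by rewrite (mulrC e).
Qed.

(** The means along the reset chain approximate both the time integral, almost
surely, and the invariant mean; they cancel, and the error vanishes as the
coalescence tolerance [j.+1%:R^-1] does. *)
Lemma ae_bounded_observable psi L N : (forall v, 0 <= psi v) -> (forall v, psi v <= N) ->
  0 <= L -> lip_bound L psi ->
  {ae P, forall w, forall v,
    linear_equivalent (fun n => I psi v (arrival beta n w) w) (\int[mu]_v psi v)}.
Proof.
move=> p0 pN L0 hpsi.
have step j : {ae P, forall w, forall v e, 0 < e -> \forall n \near \oo,
    `|I psi v (arrival beta n w) w - b * n%:R * \int[mu]_v psi v| <=
      (2 * (L * j.+1%:R^-1 * b) + e) * n%:R}.
  have j0 : 0 < j.+1%:R^-1 :> R by rewrite invr_gt0.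
  have [r r0 coal] := hcoal j0.
  have h1 := ae_time_integral_bounded hVsep hTcont hTcontr hT0 heta_indep hbeta_indep
    heta_beta beta0 heta2 hb hb0 hb2 hp hp1 p0 L0 hpsi j0 coal pN.
  have h2 := identify_limit hVsep hTcont hTcontr beta0 hmu p0 pN hpsi hb0
    (mulr_ge0 (mulr_ge0 L0 (ltW j0)) (ltW hb0))
    (fun n => reset_mean_sum_bounds r n p0 L0 hpsi) h1.
  have := ae_time_integral_arrival hVsep hTcont hTcontr hT0 heta_indep hbeta_indep
    heta_beta beta0 heta2 hb hb2 hp hp1 p0 L0 hpsi j0 coal.
  apply: filterS => w h3 v e e0.
  have eh : 0 < e / 2 by rewrite divr_gt0.
  have := h2 _ eh; have := h3 v _ eh; apply: filterS2 => n a1 a2.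
  rewrite -[X in `|X|](subrKA (s r psi n)).
  apply: (le_trans (ler_normD _ _)); rewrite (distrC (s r psi n)).
  apply: (le_trans (lerD a1 a2)); rewrite -mulrDl; apply: ler_wpM2r => //.
  by rewrite addrACA -splitr mulr2n mulrDl mul1r.
have := ae_foralln step; apply: filterS => w h v e e0.
have e4 : 0 < e / 4 by rewrite divr_gt0.
have eh : 0 < e / 2 by rewrite divr_gt0.
have [j hj] := small_scale L0 e4.
have := h j v _ eh; apply: filterS => n hn.
apply: (le_trans hn); apply: ler_wpM2r => //.
by move: (L / j.+1%:R * b) hj => q; lra.
Qed.

Section Unbounded.
Variables (psi : V -> R) (L : R).
Hypotheses (psi0 : forall v, 0 <= psi v) (hL : 0 <= L) (hpsi : lip_bound L psi).

Let trunc N v := Num.min (psi v) N.+1%:R.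
Let excess N v := psi v - trunc N v.

Let trunc_ge0 N v : 0 <= trunc N v.
Proof. by rewrite le_min psi0 ler0n. Qed.

Let trunc_le N v : trunc N v <= N.+1%:R.
Proof. by rewrite ge_min lexx orbT. Qed.

Let trunc_lip N : lip_bound L (trunc N).
Proof. exact: lip_bound_min. Qed.

Let excess_ge0 N v : 0 <= excess N v.
Proof. by rewrite subr_ge0 ge_min lexx. Qed.

Let excess_lip N : lip_bound L (excess N).
Proof. exact: lip_bound_excess. Qed.

Let excess_le N v : excess N v <= N.+1%:R^-1 * psi v ^+ 2.
Proof.
have N0 : 0 < N.+1%:R :> R by [].
have p0 := psi0 v.
rewrite /excess /trunc; case: (leP (psi v) N.+1%:R) => h.
  by rewrite subrr mulr_ge0 ?sqr_ge0// invr_ge0.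
rewrite ler_pdivlMl//; move: (psi v) (N.+1%:R : R) p0 N0 h => x y; nra.
Qed.

Let measurable_obs f M : lip_bound M f -> measurable_fun setT (f : borel V -> R).
Proof.
by move=> hf; apply: (measurable_continuous_borel (f := id)) => //; exact: lip_bound_continuous hf.
Qed.

(** Invariance bounds the means of the truncated observables by those along one
fixed reset chain, and these are bounded uniformly in the truncation level. *)
Let trunc_mean_le : exists K, forall N, \int[mu]_v trunc N v <= K.
Proof.
have [r r0 coal] := hcoal (@ltr01 R).
exists ((1 + h2 e2 b2 (p r) psi L + (L * 1 * b + 1)) / b) => N.
have h1 := ae_time_integral_bounded hVsep hTcont hTcontr hT0 heta_indep hbeta_indep
    heta_beta beta0 heta2 hb hb0 hb2 hp hp1 (trunc_ge0 N) hL (@trunc_lip N) ltr01 coal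
    (trunc_le N).
have := identify_limit hVsep hTcont hTcontr beta0 hmu (trunc_ge0 N) (trunc_le N)
  (@trunc_lip N) hb0 (mulr_ge0 (mulr_ge0 hL ler01) (ltW hb0))
  (fun n => reset_mean_sum_bounds r n (trunc_ge0 N) hL (@trunc_lip N)) h1 ltr01.
move=> [n0 _ /(_ n0.+1 (leqnSn _)) /= hn].
have n0R : 0 < n0.+1%:R :> R by [].
have /andP[_ sle] := reset_mean_sum_bounds r n0.+1 (trunc_ge0 N) hL (@trunc_lip N).
have hh : h2 e2 b2 (p r) (trunc N) L <= h2 e2 b2 (p r) psi L.
  rewrite /h2; apply: ler_wpM2l; first exact: b2_ge0 hb2.
  rewrite /g2 lerD2r; apply: ler_wpM2l => //; apply: lerXn2r; rewrite ?nnegrE//.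
  by rewrite ge_min lexx.
rewrite ler_pdivlMr// -(ler_pM2r n0R).
move: hn; rewrite ler_norml => /andP[_]; rewrite lerBlDr => hn.
have -> : (\int[mu]_v trunc N v) * b * n0.+1%:R = b * n0.+1%:R * \int[mu]_v trunc N v.
  by rewrite mulrC mulrA mulrAC (mulrC b).
apply: (le_trans hn); rewrite [leRHS]mulrDl [leRHS]addrC; apply: lerD => //.
by apply: (le_trans sle); apply: ler_wpM2r => //; rewrite lerD2l.
Qed.

(** Finiteness of the invariant mean comes from the uniform bound on truncations,
by monotone convergence. *)
Lemma invariant_mean_finite : (\int[mu]_v (psi v)%:E)%E = (\int[mu]_v psi v)%:E /\
  (fun N => \int[mu]_v trunc N v) @ \oo --> \int[mu]_v psi v.
Proof.
have [K hK] := trunc_mean_le.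
have truncE N : (\int[mu]_v (trunc N v)%:E)%E = (\int[mu]_v trunc N v)%:E.
  exact: (invariant_mean_fin mu (trunc_ge0 N) (trunc_le N) (@trunc_lip N)).
have mono v : {homo (fun N => (trunc N v)%:E) : m n / (m <= n)%N >-> (m <= n)%E}.
  move=> m n mn; rewrite lee_fin /trunc le_min ge_min lexx /= ge_min.
  by rewrite ler_nat ltnS mn orbT.
have cvg_int := cvg_monotone_convergence (mu := mu) measurableT
  (fun N => (measurable_EFinP _ _).2 (measurable_obs (@trunc_lip N)))
  (fun N v _ => trunc_ge0 N v : (0 <= (trunc N v)%:E)%E) (fun v _ => mono v).
have lim v : limn (fun N => (trunc N v)%:E) = (psi v)%:E.
  apply: lim_near_cst => //.
  exists (Num.truncn (psi v)) => // N /= hN; congr EFin; rewrite /trunc min_l//.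
  by apply: (le_trans (ltW (truncnS_gt _))); rewrite ler_nat.
move: cvg_int; under [X in _ --> X -> _]eq_integral do rewrite lim.
move=> cvg_int.
have fin : (\int[mu]_v (psi v)%:E)%E = (\int[mu]_v psi v)%:E.
  rewrite /Rintegral fineK// ge0_fin_numE; last by apply: mean_ge0.
  apply: (@le_lt_trans _ _ K%:E); last by rewrite ltry.
  rewrite -(cvg_lim _ cvg_int)//; apply: lime_le; first by apply/cvg_ex; eexists; exact: cvg_int.
  by apply: nearW => N; rewrite truncE lee_fin.
split=> //; move: cvg_int; rewrite fin => /fine_cvgP[_].
by apply: cvg_trans; apply: near_eq_cvg; apply: nearW => N.
Qed.

(** The tolerance is fixed before the truncation level, since the moment
bounds for the reset chain deteriorate as the tolerance decreases. *)
Lemma ae_observable : {ae P, forall w, forall v,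
    linear_equivalent (fun n => I psi v (arrival beta n w) w) (\int[mu]_v psi v)}.
Proof.
have j0 j : 0 < j.+1%:R^-1 :> R by rewrite invr_gt0.
have [r hr] := @choice _ _ (fun j rj => forall t v v', rj <= t ->
    `|T t v - T t v'| <= j.+1%:R^-1)
  (fun j => let: ex_intro2 rj _ h := hcoal (j0 j) in ex_intro _ rj h).
have h1 := ae_foralln (fun N => ae_bounded_observable (trunc_ge0 N) (trunc_le N) hL (@trunc_lip N)).
have h2 := ae_foralln (fun j => ae_foralln (fun N =>
  ae_time_integral_arrival hVsep hTcont hTcontr hT0 heta_indep hbeta_indep
    heta_beta beta0 heta2 hb hb2 hp hp1 (excess_ge0 N) hL (@excess_lip N) (j0 j) (hr j))).
have h3 := ae_arrival_rate hVsep hTcont hTcontr hT0 heta_indep hbeta_indep heta_beta beta0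
   heta2 hb hb2 hp hp1.
apply: filterS3 h1 h2 h3 => w h1 h2 h3 v e e0.
have e8 : 0 < e / 8 by rewrite divr_gt0.
have e4 : 0 < e / 4 by rewrite divr_gt0.
have [j hj] := small_scale hL e8.
pose q := b * g2 e2 (p (r j)) psi L.
have q0 : 0 <= q.
  apply: mulr_ge0; first exact: ltW.
  exact: (g2_ge0 heta2 (hp1 (r j)) psi0 hL).
have [_ cvg_m] := invariant_mean_finite.
have db : 0 < e / (8 * b) by rewrite divr_gt0// mulr_gt0.
have [N _ HN] : \forall N \near \oo,
    `|\int[mu]_v psi v - \int[mu]_v trunc N v| <= e / (8 * b) /\ q / (e / 8) <= N.+1%:R.
  apply: filterI; first by move/cvgrPdist_le : cvg_m; exact.
  exists (Num.truncn (q / (e / 8))) => // N /= hN.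
  by apply: (le_trans (ltW (truncnS_gt _))); rewrite ler_nat.
have [mN qN] := HN N (leqnn N).
have N0 : 0 < N.+1%:R :> R by [].
have := h2 j N v _ e8; have := h1 N v _ e4; apply: filterS2 => n a1 a2.
have n0 : 0 <= n%:R :> R by [].
have sle := tail_mean_sum_le (r j) n psi0 hL hpsi (ltW (j0 N)) (excess_ge0 N) hL
  (@excess_lip N) (excess_le N).
pose t := arrival beta n w.
have [k tk] := arrival_unbounded hb0 t h3.
have split : I psi v t w = I (trunc N) v t w + I (excess N) v t w.
  rewrite /time_integral -RintegralD//.
  - by apply: eq_Rintegral => u _; rewrite /excess addrC subrK.
  - exact: (integrable_path hVsep hTcont hTcontr hT0 eta beta0 (@trunc_lip N) (cst v) tk).
  - exact: (integrable_path hVsep hTcont hTcontr hT0 eta beta0 (@excess_lip N) (cst v) tk).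
have ex0 : 0 <= I (excess N) v t w by apply: Rintegral_ge0.
rewrite -/t in a1 a2 *; rewrite split.
have b1 : I (excess N) v t w <= (e / 8 + e / 8 + e / 8) * n%:R.
  move: a2; rewrite ler_norml => /andP[_]; rewrite lerBlDr => /le_trans; apply.
  apply: (le_trans (lerD (lexx _) sle)); rewrite -mulrDl; apply: ler_wpM2r => //.
  apply: lerD; first by rewrite lerD2r.
  by rewrite -/q mulrC ler_pdivrMr// mulrC -ler_pdivrMr.
have b2' : `|b * n%:R * \int[mu]_v trunc N v - b * n%:R * \int[mu]_v psi v| <= e / 8 * n%:R.
  rewrite -mulrBr normrM distrC ger0_norm ?mulr_ge0 ?(ltW hb0)//.
  apply: (@le_trans _ _ (b * n%:R * (e / (8 * b)))); first by rewrite ler_wpM2l// mulr_ge0// ltW.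
  by rewrite le_eqVlt; apply/orP; left; apply/eqP; field; rewrite gt_eqF.
move: a1 b2'; move: (I (trunc N) v t w) (I (excess N) v t w) (b * n%:R * \int[mu]_v trunc N v)
  (b * n%:R * \int[mu]_v psi v) ex0 b1 => i1 i2 m1 m2 ex0 b1 a1 b2'.
rewrite ler_norml in a1; rewrite ler_norml in b2'.
move: a1 b2' => /andP[a1 a1'] /andP[c1 c1'].
rewrite ler_norml; apply/andP; split; lra.
Qed.

(** Time integrals up to an arbitrary time are squeezed between those at the
two neighbouring arrivals. *)
Lemma ae_average_nonnegative : {ae P, forall w, forall v,
  (fun t => t^-1 * I psi v t w) @ +oo --> \int[mu]_v psi v}.
Proof.
have := ae_observable.
have := ae_arrival_rate hVsep hTcont hTcontr hT0 heta_indep hbeta_indep heta_beta beta0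
   heta2 hb hb2 hp hp1.
apply: filterS2 => w rate h v.
apply: (@cvg_average_of_arrivals _ _ (fun n => arrival beta n w) b) => //.
- exact: Rintegral_ge0.
- exact: arrival0.
- by move=> n; exact: arrival_ge0.
- move=> s t s0 st; rewrite -subr_ge0.
  have [k tk] := arrival_unbounded hb0 t rate.
  exact: (time_integralB_ge0 hVsep hTcont hTcontr hT0 eta beta0 (cst v) hpsi psi0 s0 st tk).
- by move=> t t0; apply: arrival_interval => //; exact: arrival_unbounded rate.
- exact: arrival_mono.
- move=> e e0; have /cvgrPdist_le/(_ _ e0) h1 := rate.
  near=> n.
  have n0 : 0 < n%:R :> R by rewrite ltr0n; near: n; exists 1%N.
  have : `|b - arrival beta n w / n%:R| <= e by near: n.
  move=> /(ler_wpM2r (ltW n0)); rewrite -{2}(gtr0_norm n0) -normrM mulrBl mulfVK.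
    by rewrite distrC.
  by rewrite gt_eqF.
- exact: h.
Unshelve. all: by end_near. Qed.

End Unbounded.
End Ergodic.

(** * Moments of the exponential law *)

Lemma mean_indicator {d} {Omega : measurableType d} {R : realType}
    (P : probability Omega R) (A : Omega -> bool) : measurable [set w | A w] ->
  (\int[P]_w (if A w then 1 else 0 : R)%:E = P [set w | A w])%E.
Proof.
move=> mA; rewrite -(setIT [set w | _]) -integral_indic//; apply: eq_integral => w _.
congr EFin; rewrite indicE; case: ifP => h; first by rewrite mem_set.
by rewrite memNset//= h.
Qed.

Section ExponentialMoments.
Context {d : measure_display} {Omega : measurableType d} {R : realType}.
Variable P : probability Omega R.
Notation mean f := (\int[P]_w (f w)%:E)%E.
Variables (theta : R) (X : {RV P >-> R}).
Hypotheses (htheta : 0 < theta) (X0 : forall w, 0 < X w)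
  (hX : exponentially_distributed theta X).

Lemma exponential_le x : 0 < x -> P [set w | X w <= x] = (1 - expR (- theta * x))%:E.
Proof.
move=> x0; rewrite EFinB -(exponential_prob_itv0c theta x0) -hX//.
rewrite /distribution /pushforward; congr (P _).
apply/seteqP; split => w /=; rewrite in_itv /=; last by case/andP.
by move=> ->; rewrite ltW.
Qed.

Lemma exponential_gt x : 0 < x -> P [set w | x < X w] = (expR (- theta * x))%:E.
Proof.
move=> x0.
have mA : measurable [set w | X w <= x].
  have := measurable_fun_ler (measurable_funPT X) (measurable_cst x).
  by move=> /(_ measurableT [set true]); rewrite setTI; apply.
have -> : [set w | x < X w] = ~` [set w | X w <= x].
  by apply/seteqP; split => w /=; rewrite ltNge => /negP.
by rewrite probability_setC// exponential_le// -EFinB opprB addrC subrK.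
Qed.

Lemma sqr_layer (x : R) : 1 < x -> exists k, k.+1%:R < x /\ x ^+ 2 <= k.+2%:R ^+ 2.
Proof.
move=> x1.
have ex : exists n, x <= n%:R.
  by exists (Num.truncn x).+1; exact/ltW/truncnS_gt.
have [n xn nmin] := ex_minnP ex.
case: n xn nmin => [|[|k]] xn nmin.
- by move: (lt_le_trans x1 xn); rewrite ltr10.
- by move: (lt_le_trans x1 xn); rewrite ltxx.
exists k; split; last by rewrite ler_pXn2r ?nnegrE// ltW// (lt_trans ltr01).
by rewrite ltNge; apply/negP => /nmin; rewrite ltnn.
Qed.

(** Squares are controlled layer by layer, the layers having the exponentially
small probabilities [P [set w | k.+1 < X w]]. *)
Lemma exponential_second_moment :
  (mean (fun w => X w ^+ 2)%R <= (1 + 96 / theta ^+ 4 * 2)%:E)%E.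
Proof.
pose D k w : R := k.+2%:R ^+ 2 * (if k.+1%:R < X w then 1 else 0).
have mA k : measurable [set w | k.+1%:R < X w].
  have := measurable_fun_ltr (measurable_cst (k.+1%:R : R)) (measurable_funPT X).
  by move=> /(_ measurableT [set true]); rewrite setTI; apply.
have mI k : measurable_fun setT (fun w => if k.+1%:R < X w then 1 else 0 : R).
  by apply: measurable_fun_ifT => //; exact: measurable_fun_ltr.
have I0 k w : 0 <= (if k.+1%:R < X w then 1 else 0 : R) by case: ifP.
have mD k : measurable_fun setT (D k) by exact: measurable_funM.
have D0 k w : 0 <= D k w by rewrite mulr_ge0 ?sqr_ge0.
have Dle k : (mean (D k) <= (96 / theta ^+ 4 * k.+1%:R ^- 2)%:E)%E.
  rewrite meanZ ?sqr_ge0// mean_indicator// exponential_gt// -EFinM lee_fin mulNr expRN.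
  have y0 : 0 < theta * k.+1%:R by rewrite mulr_gt0.
  (* 96 = 4 * 24 comes from (k + 2)^2 <= 4 (k + 1)^2 and exp(-y) <= 24 / y^4 *)
  have := expR_ge1Dxn 3 (ltW y0); rewrite (_ : 4`! = 24%N) => [h|]; last by rewrite !factS fact0.
  have h' : (theta * k.+1%:R) ^+ 4 / 24 <= expR (theta * k.+1%:R) by move: h; lra.
  have q0 : 0 < (theta * k.+1%:R) ^+ 4 / 24 by rewrite divr_gt0// exprn_gt0.
  apply: (@le_trans _ _ (k.+2%:R ^+ 2 * ((theta * k.+1%:R) ^+ 4 / 24)^-1)).
    apply: ler_wpM2l; first exact: sqr_ge0.
    by rewrite lef_pV2// posrE ?expR_gt0.
  have k1 : 1 <= k.+1%:R :> R by rewrite ler1n.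
  rewrite -(natr1 k.+1); move: (k.+1%:R : R) k1 => x x1.
  have x0 : x != 0 by rewrite gt_eqF// (lt_le_trans ltr01).
  have th0 : theta != 0 by rewrite gt_eqF.
  rewrite -subr_ge0 (_ : _ - _ = 24 * (4 * x ^+ 2 - (x + 1) ^+ 2) / (theta * x) ^+ 4).
    rewrite divr_ge0 ?exprn_even_ge0// mulr_ge0//; nra.
  by field; rewrite x0 th0.
pose F w := (\sum_(0 <= k <oo) (D k w)%:E)%E.
have F0 w : (0 <= F w)%E by apply: nneseries_ge0 => k _ _; rewrite lee_fin.
have mF : measurable_fun setT F.
  apply: ge0_emeasurable_sum => [k w _ _|k _]; first by rewrite lee_fin.
  exact/measurable_EFinP.
apply: (@le_trans _ _ (\int[P]_w (1%:E + F w))%E).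
  apply: ge0_le_integral => //.
  - by move=> w _; rewrite lee_fin sqr_ge0.
  - by apply/measurable_EFinP; exact: measurable_funX.
  - by apply: emeasurable_funD.
  - move=> w _; have [x1|x1] := leP (X w) 1.
      apply: (@le_trans _ _ 1%:E); last by rewrite leeDl.
      by rewrite lee_fin expr_le1// ltW.
    have [k [k1 k2]] := sqr_layer x1.
    apply: (@le_trans _ _ (F w)); last by rewrite leeDr.
    apply: (le_trans _ (nneseries_lim_ge k.+1 _)); last by move=> n _ _; rewrite lee_fin.
    rewrite big_nat_recr//= -[leLHS]add0e; apply: leeD.
      by apply: sume_ge0 => i _; rewrite lee_fin.
    by rewrite lee_fin /D k1 mulr1.
rewrite ge0_integralD//.
have -> : (\int[P]_w 1%:E = 1%:E)%E by exact: mean_cst.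
rewrite EFinD leeD2lE// integral_nneseries//.
- apply: lime_le; first by apply: is_cvg_nneseries => k _ _; apply: mean_ge0.
  apply: nearW => n; rewrite big_mkord.
  apply: (@le_trans _ _ (\sum_(k < n) (96 / theta ^+ 4 * k.+1%:R ^- 2)%:E)%E).
    by apply: lee_sum => k _; exact: Dle.
  rewrite sumEFin lee_fin -mulr_sumr ler_wpM2l ?divr_ge0 ?exprn_ge0 ?(ltW htheta)//.
  by apply: (le_trans (sum_inv_squares n)); rewrite gerBl divr_ge0.
- by move=> k; exact/measurable_EFinP.
- by move=> k w _; rewrite lee_fin.
Qed.

End ExponentialMoments.

Lemma identically_distributed_mean {R : realType} {d} {Omega : measurableType d}
    (P : probability Omega R) {d'} {S : measurableType d'} (X : nat -> {RV P >-> S})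
    (f : S -> \bar R) k : identically_distributed X ->
  measurable_fun setT f -> (forall y, (0 <= f y)%E) ->
  (\int[P]_w f (X k w) = \int[P]_w f (X 0%N w))%E.
Proof.
move=> hX mf f0.
rewrite -[LHS](ge0_integral_distribution (X k))// -[RHS](ge0_integral_distribution (X 0%N))//.
by apply: eq_measure_integral => A mA _; exact: hX.
Qed.

(** * Signed observables *)

Theorem theorem0p4p6 (R : realType)
  (d : measure_display) (Omega : measurableType d) (P : probability Omega R)
  (hP : measure_is_complete P)
  (V : completeNormedModType R) (hVsep : separable_space V)
  (hV0 : exists v : V, v != 0)
  (T : R -> V -> V)
  (hTsg : semigroup T) (hTcont : time_continuous T) (hTcontr : contractive T)
  (eta : nat -> {RV P >-> borel V})
  (heta_indep : independent_rvs P eta)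
  (heta_id : identically_distributed eta)
  (heta_L2 : forall k, (fun w => `|eta k w : V|) \in Lfun P 2%:E)
  (theta : R) (htheta : 0 < theta)
  (beta : nat -> {RV P >-> R})
  (hbeta_pos : forall m w, 0 < beta m w)
  (hbeta_indep : independent_rvs P beta)
  (hbeta_exp : forall m, exponentially_distributed theta (beta m))
  (heta_beta : independent2 P (sigma_seq eta) (sigma_seq beta))
  (* W is a linear subspace of V through the injection iota *)
  (W : completeNormedModType R) (hWsep : separable_space W)
  (iota : {linear W -> V}) (hiota_inj : injective iota)
  (hiota_cont : continuous iota) (hiota_dense : dense (range iota))
  (hTW : forall (t : R) (w : W), 0 <= t -> range iota (T t (iota w)))
  (kappa rho : R) (hkappa : 0 < kappa) (hrho : 0 < rho)
  (hTWdecay : forall (t : R) (w1 w2 u1 u2 : W), 0 <= t ->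
     iota u1 = T t (iota w1) -> iota u2 = T t (iota w2) ->
     `|u1 - u2| <=
       if w1 == w2 then 0
       else (kappa * t + `|w1 - w2| `^ (- rho^-1)) `^ (- rho))
  (hT0 : forall t : R, 0 <= t -> T t 0 = 0)
  (mu : probability (borel V) R) (hmu : invariant_measure P T eta beta mu)
  (psi : V -> R) (hpsi : lipschitz psi)
  (x : {RV P >-> borel V}) (hx : independent_initial P eta beta x) :
  {ae P, forall w,
    t^-1 * (\int[lebesgue_measure]_(tau in `[0, t])
              psi (process T eta beta x tau w)) @[t --> +oo]
    --> \int[mu]_v psi v}.
Proof.
have [L0 [_ hL0]] := hpsi.
pose L := Num.max (L0 + 1) 0.
have hL : 0 <= L by rewrite le_max lexx orbT.
have lip : lip_bound L psi.
  move=> v v'; apply: (hL0 L _ (v, v')) => //.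
  by rewrite lt_max ltrDl ltr01.
pose pos v := Num.max (psi v) 0; pose neg v := Num.max (- psi v) 0.
have pos0 v : 0 <= pos v by exact: max0_ge0.
have neg0 v : 0 <= neg v by exact: max0_ge0.
have pos_lip : lip_bound L pos := lip_bound_pos lip.
have neg_lip : lip_bound L neg := lip_bound_neg lip.
have psiE v : psi v = pos v - neg v.
  by rewrite /pos /neg; case: (leP (psi v) 0) => ?; case: (leP (- psi v) 0) => ?; lra.
have hcoal := coalescing_of_decay hTcontr hiota_cont hiota_dense hTW hkappa hrho hTWdecay.
pose mean (f : Omega -> R) := (\int[P]_w (f w)%:E)%E.
pose e2 := fine (mean (fun w => `|eta 0%N w : V| ^+ 2)).
have heta2 k : (mean (fun w => `|eta k w : V| ^+ 2)%R <= e2%:E)%E.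
  have mn : measurable_fun setT (fun v : borel V => (`|v : V| ^+ 2)%:E).
    apply/measurable_EFinP; apply: measurable_funX.
    by apply: (measurable_continuous_borel (f := id)) => //; exact: norm_continuous.
  rewrite /mean (identically_distributed_mean k heta_id mn); last first.
    by move=> v; rewrite lee_fin sqr_ge0.
  have /integrableP[_] := Lfun2_integrable_sqr (heta_L2 0%N).
  under eq_integral do rewrite /= ger0_norm ?sqr_ge0//.
  move=> fin; rewrite /e2 /mean fineK// ge0_fin_numE//.
  by apply: integral_ge0 => w _; rewrite lee_fin sqr_ge0.
pose b2 := 1 + 96 / theta ^+ 4 * 2.
have hb2 k : (mean (fun w => beta k w ^+ 2)%R <= b2%:E)%E.
  exact: exponential_second_moment htheta (hbeta_pos k) (hbeta_exp k).
have beta_id : identically_distributed beta.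
  by move=> k l B mB; rewrite (hbeta_exp k B mB) (hbeta_exp l B mB).
pose b := fine (mean (beta 0%N)).
have hb k : mean (beta k) = b%:E.
  have mabs : measurable_fun setT (fun u : R => `|u|%:E).
    by apply/measurable_EFinP; exact: (@measurableT_comp _ _ _ _ _ _ (@Num.norm _ R) _ id).
  have absE l : mean (beta l) = (\int[P]_w `|beta l w|%:E)%E.
    by apply: eq_integral => w _; rewrite gtr0_norm.
  have -> : mean (beta k) = mean (beta 0%N).
    by rewrite !absE (identically_distributed_mean k beta_id mabs).
  rewrite /b fineK// ge0_fin_numE; last by apply: mean_ge0 => w; exact: ltW.
  apply: (@le_lt_trans _ _ (1 + b2)%:E); last by rewrite ltry.
  by apply: mean_le1sqr; [|move=> w; exact: ltW|exact: hb2].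
pose p r := fine (mean (short beta r 0)).
have mshort r k : measurable_fun setT (short beta r k).
  by apply: measurable_fun_ifT => //; exact: measurable_fun_ltr.
have short_le1 r k : (mean (short beta r k) <= 1%:E)%E.
  rewrite -(mean_cst P 1); apply: mean_le => //; first exact: short_ge0.
  by move=> w; rewrite /short /=; case: ifP.
have hp r k : mean (short beta r k) = (p r)%:E.
  have mi : measurable_fun setT (fun u : R => (if u < r then 1 else 0 : R)%:E).
    by apply/measurable_EFinP; apply: measurable_fun_ifT => //; exact: measurable_fun_ltr.
  have -> : mean (short beta r k) = mean (short beta r 0).
    apply: (identically_distributed_mean k beta_id mi).
    by move=> u; rewrite lee_fin; case: ifP.
  rewrite /p fineK// ge0_fin_numE; last by apply: mean_ge0 => w; exact: short_ge0.
  exact: le_lt_trans (short_le1 _ _) (ltry _).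
have mlong (y : R) : measurable [set w | y < beta 0%N w].
  have := measurable_fun_ltr (measurable_cst y) (measurable_funPT (beta 0%N)).
  by move=> /(_ measurableT [set true]); rewrite setTI; apply.
have long_gt0 (y : R) : 0 < y -> (0 < P [set w | (y < beta 0%N w)%R])%E.
  move=> y0; rewrite (exponential_gt (hbeta_pos 0%N) (hbeta_exp 0%N) y0).
  by rewrite lte_fin expR_gt0.
have mind (y : R) : measurable_fun setT (fun w => if y < beta 0%N w then 1 else 0 : R).
  by apply: measurable_fun_ifT => //; exact: measurable_fun_ltr.
have ind0 (y : R) w : 0 <= (if y < beta 0%N w then 1 else 0 : R) by case: ifP.
(* legs of duration r are exceeded with positive probability *)
have hp1 r : p r < 1.
  pose y := Num.max r 1.
  have y0 : 0 < y by rewrite lt_max ltr01 orbT.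
  rewrite -lte_fin -(hp r 0%N).
  have : (mean (short beta r 0) + P [set w | (y < beta 0%N w)%R] <= 1%:E)%E.
    rewrite -(mean_indicator P (mlong y)) /mean -meanD//; last exact: short_ge0.
    rewrite -(mean_cst P 1); apply: mean_le => //.
    - exact: measurable_funD.
    - by move=> w; rewrite addr_ge0// short_ge0.
    - move=> w; rewrite /short /=; case: ifP => h1; case: ifP => h2; rewrite ?addr0 ?add0r//.
      by move: h2; rewrite /y gt_max => /andP[/(lt_trans h1)]; rewrite ltxx.
  apply: lt_le_trans; rewrite hp lteDl//; exact: long_gt0.
have hb0 : 0 < b.
  rewrite -lte_fin -(hb 0%N).
  apply: (lt_le_trans (long_gt0 1 ltr01)); rewrite -(mean_indicator P (mlong 1)).
  by apply: mean_le => // w; case: ifP => [/ltW//|_]; exact: ltW.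
have avg psi' M (p0 : forall v, 0 <= psi' v) (l : lip_bound M psi') (M0 : 0 <= M) :=
  ae_average_nonnegative hVsep hTcont hTcontr hT0 hcoal heta_indep hbeta_indep heta_beta
    hbeta_pos heta2 hb hb0 hb2 hp hp1 hmu p0 M0 l.
have fin psi' M (p0 : forall v, 0 <= psi' v) (l : lip_bound M psi') (M0 : 0 <= M) :=
  invariant_mean_finite hVsep hTcont hTcontr hT0 hcoal heta_indep hbeta_indep heta_beta
    hbeta_pos heta2 hb hb0 hb2 hp hp1 hmu p0 M0 l.
have integrable_obs psi' M (p0 : forall v, 0 <= psi' v) (l : lip_bound M psi') (M0 : 0 <= M) :
    mu.-integrable setT (EFin \o (psi' : borel V -> R)).
  apply/integrableP; split.
    apply/measurable_EFinP; apply: (measurable_continuous_borel (f := id)) => //.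
    exact: lip_bound_continuous l.
  have [e _] := fin psi' M p0 l M0.
  under eq_integral do rewrite /= ger0_norm//.
  by rewrite e ltry.
have -> : \int[mu]_v psi v = \int[mu]_v pos v - \int[mu]_v neg v.
  rewrite -RintegralB//; [|exact: integrable_obs pos_lip hL|exact: integrable_obs neg_lip hL].
  by apply: eq_Rintegral => v _.
have rate := ae_arrival_rate hVsep hTcont hTcontr hT0 heta_indep hbeta_indep heta_beta
  hbeta_pos heta2 hb hb2 hp hp1.
apply: filterS3 (avg pos L pos0 pos_lip hL) (avg neg L neg0 neg_lip hL) rate => w cpos cneg cr.
apply: (cvg_trans _ (cvgB (cpos (x w)) (cneg (x w)))); apply: near_eq_cvg; near=> t.
rewrite /= -mulrBr; congr (_ * _).
have [k tk] := arrival_unbounded hb0 t cr.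
rewrite -[LHS]/(time_integral T eta beta pos (cst (x w)) t w -
  time_integral T eta beta neg (cst (x w)) t w) /time_integral -RintegralB//; last 2 first.
- exact: (integrable_path hVsep hTcont hTcontr hT0 eta hbeta_pos pos_lip (cst (x w)) tk).
- exact: (integrable_path hVsep hTcont hTcontr hT0 eta hbeta_pos neg_lip (cst (x w)) tk).
apply: eq_Rintegral => u _; rewrite -psiE; congr psi.
by apply/esym; exact: (process_comp T (fun k => eta k : Omega -> V)
  (fun k => beta k : Omega -> R) id x (cst u) w).
Unshelve. all: by end_near. Qed.
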